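(* Let $(M,\varphi,g)$ be an almost Golden Riemannian manifold. There exists a unique derivation law $\nabla^{\mathrm w}$ on $M$ adapted to $(\varphi,g)$ (i.e. with $\nabla^{\mathrm w}\varphi=0$ and $\nabla^{\mathrm w}g=0$) satisfying $$g(\mathrm{T}^{\mathrm w}(X,Y),Z)=g(\mathrm{T}^{\mathrm w}(Z,Y),X),\quad\forall X,Z\in D_\phi,\ \forall Y\in\mathfrak{X}(M),$$ $$g(\mathrm{T}^{\mathrm w}(X,Y),Z)=g(\mathrm{T}^{\mathrm w}(Z,Y),X),\quad\forall X,Z\in D_{\bar\phi},\ \forall Y\in\mathfrak{X}(M),$$ where $\mathrm{T}^{\mathrm w}$ denotes the torsion tensor of $\nabla^{\mathrm w}$.
   Context: Manifolds and tensor fields are of class $C^\infty$; $\mathfrak{X}(M)$ denotes the module of vector fields on $M$. A derivation law on $M$ is the covariant derivative of a linear connection on $M$. An almost Golden structure on $M$ is a tensor field $\varphi$ of type $(1,1)$ with $\varphi^2=\varphi+Id$ (a polynomial structure of degree exactly 2, i.e. $\varphi$ and $Id$ are linearly independent). An almost Golden Riemannian manifold $(M,\varphi,g)$ is a manifold with an almost Golden structure $\varphi$ and a Riemannian metric $g$ such that $g(\varphi X,Y)=g(X,\varphi Y)$ for all $X,Y\in\mathfrak{X}(M)$. Let $\phi=\frac{1+\sqrt5}{2}$, $\bar\phi=\frac{1-\sqrt5}{2}$; $D_\phi=\ker(\varphi-\phi\, Id)$ and $D_{\bar\phi}=\ker(\varphi-\bar\phi\, Id)$ are the eigendistributions of $\varphi$,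 and $X\in D_\phi$ means that $X$ is a vector field on $M$ taking values in $D_\phi$ (similarly for $D_{\bar\phi}$). The derivation law $\nabla^{\mathrm w}$ is called the well adapted connection of $(\varphi,g)$. *)

(* Defs.v *)
From HB Require Import structures.
From mathcomp Require Import all_boot all_order all_algebra.
From mathcomp Require Import all_classical all_reals all_analysis.
From mathcomp Require Import ring.

Set Implicit Arguments.
Unset Strict Implicit.
Unset Printing Implicit Defensive.

Import Order.TTheory GRing.Theory Num.Theory numFieldNormedType.Exports.

Local Open Scope classical_set_scope.
Local Open Scope ring_scope.

(* [Ck k U f]: all iterated partial derivatives of f of order <= k exist and  *)
(* are continuous at every point of U (U is always open in what follows).     *)
Fixpoint Ck (R : realType) (n : nat) (k : nat) (U : set 'rV[R]_n)
    (f : 'rV[R]_n -> R) : Prop :=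
  (forall x, U x -> {for x, continuous f}) /\
  if k is k'.+1 then
    forall i : 'I_n, (forall x, U x -> derivable f x (delta_mx 0 i)) /\
                     Ck k' U (fun x => 'D_(delta_mx 0 i) f x)
  else True.

Definition Cinf (R : realType) (n : nat) (U : set 'rV[R]_n)
  (f : 'rV[R]_n -> R) : Prop := forall k, Ck k U f.

Section CkTheory.
Variables (R : realType) (n : nat) (U : set 'rV[R]_n).
Hypothesis oU : open U.
Implicit Types f g : 'rV[R]_n -> R.

Lemma near_open_eq f g x : (forall y, U y -> f y = g y) -> U x ->
  {near x, f =1 g}.
Proof. by move=> fg Ux; near=> y; apply: fg; near: y; exact: open_nbhs_nbhs.
Unshelve. all: by end_near. Qed.

Lemma eq_Ck k f g : (forall x, U x -> f x = g x) -> Ck k U f -> Ck k U g.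
Proof.
have cfg f' g' : (forall x, U x -> f' x = g' x) ->
    (forall x, U x -> {for x, continuous f'}) ->
    forall x, U x -> {for x, continuous g'}.
  move=> fg' cf' x Ux; rewrite /prop_for /continuous_at -(fg' x Ux).
  apply: (cvg_trans _ (cf' x Ux)).
  exact: (@near_eq_cvg _ _ (nbhs x) _ _ _ (near_open_eq fg' Ux)).
elim: k f g => [|k IH] f g fg [cf df]; split; first exact: cfg cf.
- by [].
- exact: cfg cf.
move=> i; have [d1 d2] := df i; split=> [x Ux|].
  exact: near_eq_derivable (near_open_eq fg Ux) (d1 x Ux).
by apply: IH d2 => x Ux; exact/near_eq_derive/near_open_eq.
Qed.

Lemma CkW k f : Ck k.+1 U f -> Ck k U f.
Proof.
elim: k f => [|k IH] f [cf df]; split=> //= i.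
by have [d1 d2] := df i; split=> //; exact: IH.
Qed.

Lemma Ck_cst k (a : R) : Ck k U (fun=> a).
Proof.
elim: k a => [|k IH] a; split=> //; try by move=> x _; exact: cst_continuous.
move=> i; split=> [x _|]; first exact: derivable_cst.
by apply: (eq_Ck (f := fun=> 0)) => // x _; rewrite derive_cst.
Qed.

Lemma CkD k f g : Ck k U f -> Ck k U g -> Ck k U (fun x => f x + g x).
Proof.
elim: k f g => [|k IH] f g [cf df] [cg dg]; (split; [|]) => //.
- by move=> x Ux; apply: continuousD; [exact: cf|exact: cg].
- by move=> x Ux; apply: continuousD; [exact: cf|exact: cg].
move=> i; have [df1 df2] := df i; have [dg1 dg2] := dg i.
split=> [x Ux|]; first exact: derivableD (df1 _ Ux) (dg1 _ Ux).
apply: eq_Ck (IH _ _ df2 dg2) => x Ux.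
by rewrite deriveD; [by []|exact: df1|exact: dg1].
Qed.

Lemma CkM k f g : Ck k U f -> Ck k U g -> Ck k U (fun x => f x * g x).
Proof.
elim: k f g => [|k IH] f g; move=> Cf Cg; have [cf df] := Cf;
  have [cg dg] := Cg; (split; [|]) => //.
- by move=> x Ux; apply: continuousM; [exact: cf|exact: cg].
- by move=> x Ux; apply: continuousM; [exact: cf|exact: cg].
move=> i; have [df1 df2] := df i; have [dg1 dg2] := dg i.
split=> [x Ux|]; first exact: derivableM (df1 _ Ux) (dg1 _ Ux).
apply: eq_Ck (CkD (IH _ _ (CkW Cf) dg2) (IH _ _ (CkW Cg) df2)) => x Ux.
by rewrite deriveM; [by []|exact: df1|exact: dg1].
Qed.

End CkTheory.

Record chart (R : realType) (M : topologicalType) (n : nat) := Chart {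
  chart_dom : set M;
  chart_fun :> M -> 'rV[R]_n;
  chart_inv : 'rV[R]_n -> M;
  chart_dom_open : open chart_dom;
  chart_img_open : open (chart_fun @` chart_dom);
  chart_funK : {in chart_dom, cancel chart_fun chart_inv};
  chart_fun_continuous : {in chart_dom, continuous chart_fun};
  chart_inv_continuous :
    {in chart_fun @` chart_dom, continuous chart_inv}
}.

Arguments chart_dom_open {R M n} c.
Arguments chart_img_open {R M n} c.
Arguments chart_funK {R M n} c.
Arguments chart_fun_continuous {R M n} c.
Arguments chart_inv_continuous {R M n} c.

(* An n-dimensional manifold of class C^oo; the atlas need not be maximal.    *)
Record smooth_manifold (R : realType) (n : nat) := SmoothManifold {
  mfd_space :> topologicalType;
  mfd_hausdorff : hausdorff_space mfd_space;
  mfd_second_countable : @second_countable mfd_space;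
  mfd_atlas : set (chart R mfd_space n);
  mfd_cover : forall p : mfd_space,
    exists2 c, mfd_atlas c & chart_dom c p;
  mfd_compat : forall c d, mfd_atlas c -> mfd_atlas d -> forall i : 'I_n,
    Cinf (c @` (chart_dom c `&` chart_dom d))
         (fun x => d (chart_inv c x) 0 i)
}.

Arguments mfd_hausdorff {R n} s.
Arguments mfd_second_countable {R n} s.
Arguments mfd_cover {R n} s p.
Arguments mfd_compat {R n} s c d.

(* Smoothness is tested in the charts; [smooth_fun M] is C^oo(M).              *)
Definition smooth_pred (R : realType) (n : nat) (M : smooth_manifold R n) :
    {pred M -> R} :=
  fun f => `[< forall c, mfd_atlas c ->
               Cinf (c @` chart_dom c) (f \o chart_inv c) >].
Arguments smooth_pred {R n} M.

Section SmoothFunctions.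
Variables (R : realType) (n : nat) (M : smooth_manifold R n).

Lemma smooth_subring_closed : subring_closed (smooth_pred M).
Proof.
have smM f g : f \in smooth_pred M -> g \in smooth_pred M ->
    f * g \in smooth_pred M.
  move=> /asboolP sf /asboolP sg; apply/asboolP => c cM k.
  exact: (CkM (chart_img_open c) (sf c cM k) (sg c cM k)).
have smC (a : R) : cst a \in smooth_pred M.
  by apply/asboolP => c cM k; exact: (Ck_cst (chart_img_open c)).
split=> [|f g sf sg|]; [exact: smC| |exact: smM].
have -> : f - g = f + cst (-1) * g.
  by apply/funext => x; rewrite !fctE mulN1r.
move/asboolP: (smM _ _ (smC (-1)) sg) => smg; move/asboolP: sf => sf.
apply/asboolP => c cM k.
exact: (CkD (chart_img_open c) (sf c cM k) (smg c cM k)).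
Qed.
HB.instance Definition _ :=
  GRing.isSubringClosed.Build (M -> R) (smooth_pred M) smooth_subring_closed.

Lemma smooth_scaler_closed : GRing.scaler_closed (smooth_pred M).
Proof.
move=> a f sf.
have -> : a *: f = cst a * f by [].
apply: rpredM sf; apply/asboolP => c cM k.
exact: (Ck_cst (chart_img_open c)).
Qed.
HB.instance Definition _ :=
  GRing.isScaleClosed.Build R (M -> R) (smooth_pred M) smooth_scaler_closed.

Record smooth_fun := SmoothFun {
  smooth_fun_val :> M -> R;
  _ : smooth_fun_val \in smooth_pred M }.
HB.instance Definition _ := [isSub for smooth_fun_val].
HB.instance Definition _ := [Choice of smooth_fun by <:].
HB.instance Definition _ := 
  GRing.SubChoice_isSubComPzRing.Build (M -> R) (smooth_pred M) smooth_fun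
    smooth_subring_closed.
HB.instance Definition _ := [SubZmodule_isSubLmodule of smooth_fun by <:].

End SmoothFunctions.

(* The tangent space at p: derivations of C^oo(M) at p.                       *)
Definition tangent_pred (R : realType) (n : nat) (M : smooth_manifold R n)
    (p : M) : {pred smooth_fun M -> R} :=
  fun v => `[< (forall a f g, v (a *: f + g) = a * v f + v g) /\
               (forall f g, v (f * g) = v f * g p + f p * v g) >].
Arguments tangent_pred {R n} M p.

Section Tangent.
Variables (R : realType) (n : nat) (M : smooth_manifold R n) (p : M).

Lemma tangent_submod_closed : submod_closed (tangent_pred M p).
Proof.
have addE (u v : smooth_fun M -> R) f : (u + v) f = u f + v f by [].
have sclE a (u : smooth_fun M -> R) f : (a *: u) f = a * u f by [].
split=> [|a u v /asboolP[lu du] /asboolP[lv dv]]; apply/asboolP; split.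
- by move=> a f g; rewrite /= mulr0 addr0.
- by move=> f g; rewrite /= mul0r mulr0 addr0.
- move=> b f g; rewrite !(addE, sclE) lu lv; ring.
- move=> f g; rewrite !(addE, sclE) du dv; ring.
Qed.
HB.instance Definition _ :=
  GRing.isSubmodClosed.Build R (smooth_fun M -> R) (tangent_pred M p)
    tangent_submod_closed.

Record tangent := Tangent {
  tangent_val :> smooth_fun M -> R;
  _ : tangent_val \in tangent_pred M p }.
HB.instance Definition _ := [isSub for tangent_val].
HB.instance Definition _ := [Choice of tangent by <:].
HB.instance Definition _ := [SubChoice_isSubLmodule of tangent by <:].

End Tangent.
Arguments tangent {R n} M p.

Section VectorFields.
Variables (R : realType) (n : nat) (M : smooth_manifold R n).
Local Notation F := (smooth_fun M).

(* A vector field is the derivation f |-> X f of C^oo(M); the regular module  *)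
(* F^o as codomain is only there to make functions F -> F a module over F.    *)
Definition vector_field_pred : {pred F -> F^o} :=
  fun X => `[< (forall (a : R) (f g : F), X (a *: f + g) = a *: X f + X g) /\
               (forall f g : F, X (f * g) = X f * g + f * X g) >].

Lemma smooth_fun_ext (f g : F) : (forall p, f p = g p) -> f = g.
Proof. by move=> fg; apply/val_inj/funext. Qed.

Lemma smooth_funE :
  ((forall (f g : F) (p : M), (f + g)%R p = (f p + g p)%R) *
   (forall (f g : F) (p : M), (f * g)%R p = (f p * g p)%R) *
   (forall (a : R) (f : F) (p : M), (a *: f)%R p = (a * f p)%R))%type.
Proof. by []. Qed.

Lemma vector_field_submod_closed : submod_closed vector_field_pred.
Proof.
split=> [|h X Y /asboolP[lX dX] /asboolP[lY dY]]; apply/asboolP; split.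
- by move=> a f g; rewrite /= scaler0 addr0.
- by move=> f g; rewrite /= mul0r mulr0 addr0.
- move=> a f g; apply: smooth_fun_ext => p.
  have E k : (h *: X + Y) k = h * X k + Y k :> F by [].
  by rewrite !E lX lY !smooth_funE; ring.
- move=> f g; have E k : (h *: X + Y) k = h * X k + Y k :> F by [].
  by rewrite !E dX dY; ring.
Qed.
HB.instance Definition _ :=
  GRing.isSubmodClosed.Build F (F -> F^o) vector_field_pred
    vector_field_submod_closed.

Record vector_field := VectorField {
  vector_field_val :> F -> F^o;
  _ : vector_field_val \in vector_field_pred }.
HB.instance Definition _ := [isSub for vector_field_val].
HB.instance Definition _ := [Choice of vector_field by <:].
HB.instance Definition _ := [SubChoice_isSubLmodule of vector_field by <:].

Lemma vector_fieldP (X : vector_field) :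
  (forall (a : R) (f g : F), X (a *: f + g) = a *: X f + X g :> F) /\
  (forall f g : F, X (f * g) = X f * g + f * X g :> F).
Proof. by case: X => X /= /asboolP. Qed.

Lemma vf_at_subproof (X : vector_field) (p : M) :
  (fun f => (X f : F) p) \in tangent_pred M p.
Proof.
have [lX dX] := vector_fieldP X; apply/asboolP; split=> [a f g|f g].
  by rewrite lX.
by rewrite dX.
Qed.
Definition vf_at (X : vector_field) (p : M) : tangent M p :=
  Tangent (vf_at_subproof X p).

Lemma lie_bracket_subproof (X Y : vector_field) :
  (fun f => X (Y f) - Y (X f)) \in vector_field_pred.
Proof.
have [lX dX] := vector_fieldP X; have [lY dY] := vector_fieldP Y.
have addX f g : X (f + g) = X f + X g :> F by rewrite -[f]scale1r lX !scale1r.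
have addY f g : Y (f + g) = Y f + Y g :> F by rewrite -[f]scale1r lY !scale1r.
apply/asboolP; split=> [a f g|f g].
  by rewrite lX lY lX lY scalerBr opprD addrACA.
rewrite dX dY addX addY !dX !dY.
by rewrite /=; ring.
Qed.
Definition lie_bracket (X Y : vector_field) : vector_field :=
  VectorField (lie_bracket_subproof X Y).

End VectorFields.
Arguments vector_field {R n} M.
Arguments vector_field_pred {R n} M.

Section Tensors.
Variables (R : realType) (n : nat) (M : smooth_manifold R n).

(* Smoothness of a field of endomorphisms (or of inner products) means that   *)
(* it sends smooth vector fields to smooth ones (resp. to smooth functions).  *)
Record tensor11 := Tensor11 {
  tensor11_at :> forall p : M, {linear tangent M p -> tangent M p};
  tensor11_smooth : forall (X : vector_field M) (f : smooth_fun M),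
    (fun p => tensor11_at p (vf_at X p) f) \in smooth_pred M
}.

Lemma tensor11_app_subproof (t : tensor11) (X : vector_field M) :
  (fun f => SmoothFun (tensor11_smooth t X f)) \in vector_field_pred M.
Proof.
apply/asboolP; split=> [a f g|f g]; apply: smooth_fun_ext => p;
  have /asboolP[lv dv] := valP (t p (vf_at X p)).
- exact: lv.
- exact: dv.
Qed.
Definition tensor11_app (t : tensor11) (X : vector_field M) : vector_field M :=
  VectorField (tensor11_app_subproof t X).

Record riemannian_metric := RiemannianMetric {
  metric_at :> forall p : M, tangent M p -> tangent M p -> R;
  metric_linear : forall p a (u v w : tangent M p),
    metric_at (a *: u + v) w = a * metric_at u w + metric_at v w;
  metric_sym : forall p (u v : tangent M p), metric_at u v = metric_at v u;
  metric_posdef : forall p (u : tangent M p), u != 0 -> 0 < metric_at u u;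
  metric_smooth : forall X Y : vector_field M,
    (fun p => metric_at (vf_at X p) (vf_at Y p)) \in smooth_pred M
}.

Definition metric_app (g : riemannian_metric) (X Y : vector_field M) :
  smooth_fun M := SmoothFun (metric_smooth g X Y).

End Tensors.
Arguments tensor11 {R n} M.
Arguments riemannian_metric {R n} M.

Section Connections.
Variables (R : realType) (n : nat) (M : smooth_manifold R n).
Local Notation XM := (vector_field M).
Implicit Types nabla : XM -> XM -> XM.

Definition derivation_law nabla : Prop :=
  [/\ forall (f : smooth_fun M) (X Y Z : XM),
        nabla (f *: X + Y) Z = f *: nabla X Z + nabla Y Z,
      forall X Y Z : XM, nabla X (Y + Z) = nabla X Y + nabla X Z
    & forall (f : smooth_fun M) (X Y : XM),
        nabla X (f *: Y) = (X f : smooth_fun M) *: Y + f *: nabla X Y].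

Definition torsion nabla (X Y : XM) : XM :=
  nabla X Y - nabla Y X - lie_bracket X Y.

(* (nabla_X t)(Y) *)
Definition covariant_derivative_tensor11 nabla (t : tensor11 M) (X Y : XM) :
    XM :=
  nabla X (tensor11_app t Y) - tensor11_app t (nabla X Y).

(* (nabla_X g)(Y, Z) *)
Definition covariant_derivative_metric nabla (g : riemannian_metric M)
    (X Y Z : XM) : smooth_fun M :=
  (X (metric_app g Y Z) : smooth_fun M)
    - metric_app g (nabla X Y) Z - metric_app g Y (nabla X Z).

End Connections.

Section Golden.
Variables (R : realType) (n : nat) (M : smooth_manifold R n).

Definition golden_ratio : R := (1 + Num.sqrt 5) / 2.
Definition golden_ratio_conj : R := (1 - Num.sqrt 5) / 2.

(* As for polynomial structures in general, the linear independence of phi    *)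
(* and Id is required at every point.                                         *)
Definition almost_golden (phi : tensor11 M) : Prop :=
  (forall p (v : tangent M p), phi p (phi p v) = phi p v + v) /\
  (forall (p : M) (a b : R),
     (forall v : tangent M p, a *: phi p v + b *: v = 0) -> a = 0 /\ b = 0).

Definition almost_golden_riemannian (phi : tensor11 M)
    (g : riemannian_metric M) : Prop :=
  almost_golden phi /\
  forall X Y : vector_field M,
    metric_app g (tensor11_app phi X) Y = metric_app g X (tensor11_app phi Y).

Definition eigendistribution (phi : tensor11 M) (c : R) (p : M) :
    set (tangent M p) :=
  [set v | phi p v - c *: v = 0].

Definition vf_in (D : forall p : M, set (tangent M p)) (X : vector_field M) :
    Prop :=
  forall p, D p (vf_at X p).

Definition adapted_to (phi : tensor11 M) (g : riemannian_metric M)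
    (nabla : vector_field M -> vector_field M -> vector_field M) : Prop :=
  (forall X Y, covariant_derivative_tensor11 nabla phi X Y = 0) /\
  (forall X Y Z, covariant_derivative_metric nabla g X Y Z = 0).

Definition torsion_symmetric_on (D : forall p : M, set (tangent M p))
    (g : riemannian_metric M)
    (nabla : vector_field M -> vector_field M -> vector_field M) : Prop :=
  forall X Z Y : vector_field M, vf_in D X -> vf_in D Z ->
    metric_app g (torsion nabla X Y) Z = metric_app g (torsion nabla Z Y) X.

End Golden.
Arguments golden_ratio {R}.
Arguments golden_ratio_conj {R}.

(* Main.v *)
Require Import Defs.
From HB Require Import structures.
From mathcomp Require Import all_boot all_order all_algebra.
From mathcomp Require Import all_classical all_reals all_analysis.
From mathcomp Require Import ring lra.

Set Implicit Arguments.
Unset Strict Implicit.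
Unset Printing Implicit Defensive.

Import Order.TTheory GRing.Theory Num.Theory numFieldNormedType.Exports.

Local Open Scope classical_set_scope.
Local Open Scope ring_scope.

(** The proof has three layers.

    Algebra. The projectors [P] and [Q] onto the two eigendistributions are
    smooth, complementary and [g]-symmetric, and a connection is adapted exactly
    when it is metric and commutes with [P] and [Q]. Take [Y] and [Z] in the
    image of [P]. Writing Koszul's formula with torsion terms, with [P X] in
    place of [X] where nothing is differentiated along [X], one finds
    [2 g (nabla_X Y, Z) = Koszul X Y Z] plus three torsion terms. The symmetry
    of the torsion cancels two of them; the third, whose arguments all lie in
    the image of [P], is skew in two arguments and symmetric in two others,
    hence zero ([Koszul_formula]). The same holds for [Q], so [nabla] is unique.
    Conversely, this formula defines [nabla] as soon as every [C^oo(M)]-linear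
    form on vector fields is [g (W, -)] for a vector field [W], and the required
    properties are identities satisfied by [Koszul].

    Geometry. This representation of linear forms ([sharp]) is proved near each
    point by Cramer's rule in a frame and then glued. Since a vector field is by
    definition a derivation of the ring of global functions, what is needed is
    that, near each point, derivations are combinations of coordinate fields. A
    bump [b] turns all the local data into global ones, and Hadamard's expansion
    [f = f(q) + sum_i (x_i - q_i) h_i], multiplied by [b ^ 2], is an identity of
    global functions to which a derivation can be applied
    ([chart_field_decomposition]).

    Calculus. Smoothness is phrased by iterated partial derivatives, so one needs
    the chain rule for [C^k] functions ([Ck_comp]), for the transition maps; a
    smooth bump ([exists_bump]); and Hadamard's lemma ([Hadamard]), whose
    coefficients are integrals along segments. *)

(** * Calculus in several variables *)

Section Increments.
Variables (R : realType) (n : nat).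
Implicit Types (f : 'rV[R]_n -> R) (x v h : 'rV[R]_n).

Lemma is_derive_quotient f x v (l : R) :
  s^-1 * (f (s *: v + x) - f x) @[s --> 0^'] --> l -> is_derive x v f l.
Proof.
by move=> fl; apply: DeriveDef; [apply/cvg_ex; exists l|exact: cvg_lim].
Qed.

Lemma derive_quotient f x v : derivable f x v ->
  s^-1 * (f (s *: v + x) - f x) @[s --> 0^'] --> 'D_v f x.
Proof. by []. Qed.

Lemma is_derive_line f x v (s : R) : derivable f (s *: v + x) v ->
  is_derive s 1 (fun t => f (t *: v + x)) ('D_v f (s *: v + x)).
Proof.
move=> /derive_quotient df; apply: DeriveDef; last first.
  rewrite /derive; apply: cvg_lim => //.
  apply: cvg_trans df; apply: near_eq_cvg; near=> t => /=.
  by rewrite [t%:A]mulr1 scalerDl addrA.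
apply/cvg_ex; exists ('D_v f (s *: v + x)).
apply: cvg_trans df; apply: near_eq_cvg; near=> t => /=.
by rewrite [t%:A]mulr1 scalerDl addrA.
Unshelve. all: by end_near. Qed.

Lemma is_derive_line0 f x v (l : R) :
  is_derive (0 : R) (1 : R) (fun t : R => f (t *: v + x)) l -> is_derive x v f l.
Proof.
set F := fun t : R => _; move=> [dF <-]; apply: is_derive_quotient.
have : s^-1 *: (F (s *: 1 + 0) - F 0) @[s --> (0 : R)^'] --> 'D_1 F 0 by [].
apply: cvg_trans; apply: near_eq_cvg; near=> s.
by rewrite /F addr0 scale0r add0r [s%:A]mulr1.
Unshelve. all: by end_near. Qed.

(** The displacement [s *: v] may go backwards along [v]. *)
Lemma MVT_line f x v (s : R) :
  (forall t : R, 0 <= t <= 1 -> derivable f ((t * s) *: v + x) v) ->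
  exists2 t : R, 0 <= t <= 1 &
    f (s *: v + x) - f x = s * 'D_v f ((t * s) *: v + x).
Proof.
move=> df; pose F (t : R) := f ((t * s) *: v + x).
have dF (t : R) : 0 <= t <= 1 -> is_derive t 1 F (s * 'D_v f ((t * s) *: v + x)).
  move=> t01.
  have dg := is_derive_line (df t t01).
  have ds : is_derive t 1 (fun t : R => t * s) s.
    have -> : (fun t : R => t * s) = s *: id by apply/funext => r; rewrite mulrC.
    by apply: is_derive_eq; rewrite [_ *: _]mulr1.
  have := @is_derive1_comp R (fun t : R => f (t *: v + x)) (fun t : R => t * s) t.
  by move=> /(_ _ _ dg ds) h; apply: (is_derive_eq h); rewrite mulrC.
have [||c c01 E] :=
  @MVT_segment R F (fun t => s * 'D_v f ((t * s) *: v + x)) 0 1 ler01.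
- by move=> t; rewrite in_itv /= => /andP[/ltW t0 /ltW t1]; apply: dF; rewrite t0.
- apply: derivable_within_continuous => t; rewrite in_itv /= => t01.
  by have [] := dF t t01.
exists c; first by move: c01; rewrite in_itv.
by move: E; rewrite /F mul1r mul0r scale0r add0r subr0 mulr1.
Qed.

End Increments.

Section ChainRule.
Variables (R : realType).

Lemma row_entry_le n (v : 'rV[R]_n) j : `|v 0 j| <= `|v|.
Proof.
rewrite [leRHS]/Num.Def.normr /= mx_normrE.
exact: (le_bigmax _ (fun ij : 'I_1 * 'I_n => `|v ij.1 ij.2|) (0, j)).
Qed.

Lemma row_norm_le n (v : 'rV[R]_n) (e : R) : 0 <= e ->
  (forall j, `|v 0 j| <= e) -> `|v| <= e.
Proof.
move=> e0 ve; rewrite [leLHS]/Num.Def.normr /= mx_normrE.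
by apply: bigmax_le => // -[i j] _ /=; rewrite ord1.
Qed.

Lemma open_ball_norm n (U : set 'rV[R]_n) x : open U -> U x ->
  exists2 e : R, 0 < e & forall y, `|y - x| < e -> U y.
Proof.
move=> oU Ux; have /nbhs_ballP[e /= e0 eU] : nbhs x U by exact: open_nbhs_nbhs.
exists e => // y yx; apply: eU.
by rewrite -ball_normE /ball_ /= distrC.
Qed.

(** Increasing the coordinates one at a time turns an increment of [f] into
    increments along the axes, to each of which the mean value theorem applies;
    continuity of the partial derivatives at [x] then gives the limits. *)
Lemma C1_increment n (U : set 'rV[R]_n) f x : open U -> Ck 1 U f -> U x ->
  exists a : 'I_n -> 'rV[R]_n -> R,
    (forall k, a k h @[h --> (0 : 'rV[R]_n)] --> 'D_(delta_mx 0 k) f x) /\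
    (\forall h \near (0 : 'rV[R]_n), f (h + x) - f x = \sum_(k < n) h 0 k * a k h).
Proof.
move=> oU [_ df] Ux; have [e e0 eU] := open_ball_norm oU Ux.
pose z (h : 'rV[R]_n) (k : nat) : 'rV[R]_n :=
  \row_j (if (j < k)%N then h 0 j else 0) + x.
have zS h (k : 'I_n) : z h k.+1 = h 0 k *: delta_mx 0 k + z h k.
  apply/rowP => j; rewrite !mxE /=; have [->|jk] := eqVneq j k.
    by rewrite ltnSn ltnn mulr1 add0r.
  by rewrite mulr0 add0r ltnS leq_eqVlt (negbTE (jk : j != k :> nat)).
have P (kh : 'I_n * 'rV[R]_n) : exists y : 'rV[R]_n, `|y - x| <= `|kh.2| /\
    (`|kh.2| < e -> f (z kh.2 kh.1.+1) - f (z kh.2 kh.1) =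
                    kh.2 0 kh.1 * 'D_(delta_mx 0 kh.1) f y).
  case: kh => k h /=.
  have zle (t : R) : 0 <= t <= 1 ->
      `|(t * h 0 k) *: delta_mx 0 k + z h k - x| <= `|h|.
    move=> /andP[t0 t1]; apply: row_norm_le => // j.
    rewrite !mxE /= -!addrA subrr addr0; have [->|jk] := eqVneq j k.
      rewrite ltnn mulr1 addr0 normrM (ger0_norm t0).
      by apply: le_trans (row_entry_le h k); rewrite ler_piMl.
    by rewrite mulr0 add0r; case: ifP; rewrite ?row_entry_le ?normr0.
  have [he|he] := ltP `|h| e; last first.
    by exists x; rewrite subrr normr0; split => // /(le_lt_trans he); rewrite ltxx.
  have [|t t01 E] := @MVT_line R n f (z h k) (delta_mx 0 k) (h 0 k).
    move=> t t01; apply: (df k).1; apply: eU.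
    exact: le_lt_trans (zle t t01) he.
  exists ((t * h 0 k) *: delta_mx 0 k + z h k); split; first exact: zle.
  by move=> _; rewrite zS.
have [y yP] := choice P.
exists (fun k h => 'D_(delta_mx 0 k) f (y (k, h))); split=> [k|].
  have cDf : {for x, continuous ('D_(delta_mx 0 k) f)} by exact: (df k).2.1.
  apply: (cvg_comp (fun h => y (k, h)) ('D_(delta_mx 0 k) f)) cDf.
  apply/(@cvgrPdist_lt _ _ _ (nbhs (0 : 'rV[R]_n)) (nbhs_filter _)) => d d0.
  apply/nbhs_ballP; exists d => //= h.
  rewrite -ball_normE /ball_ /= sub0r normrN => hd; rewrite distrC.
  exact: le_lt_trans (yP (k, h)).1 hd.
apply/nbhs_ballP; exists e => //= h; rewrite -ball_normE /ball_ /= sub0r normrN => he.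
under eq_bigr => k _ do rewrite -((yP (k, h)).2 he) /=.
rewrite -(big_mkord xpredT (fun k => f (z h k.+1) - f (z h k))) telescope_sumr //.
congr (f _ - f _); apply/rowP => j; rewrite !mxE ?ltn_ord //=.
by rewrite add0r.
Qed.

(** The increments of [phi] vanish with the step, so the coefficients given by
    [C1_increment] converge; only directional derivatives of [phi] are involved. *)
Lemma is_derive_C1_comp m n (U : set 'rV[R]_n) (f : 'rV[R]_n -> R)
    (phi : 'rV[R]_m -> 'rV[R]_n) x v (dphi : 'I_n -> R) :
  open U -> Ck 1 U f -> U (phi x) ->
  (forall i, is_derive x v (fun y => phi y 0 i) (dphi i)) ->
  is_derive x v (f \o phi)
    (\sum_(i < n) dphi i * 'D_(delta_mx 0 i) f (phi x)).
Proof.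
move=> oU Cf Ux dphiP; have [a [aP aE]] := C1_increment oU Cf Ux.
pose h (s : R) := phi (s *: v + x) - phi x.
have h0 : h s @[s --> 0^'] --> (0 : 'rV[R]_n).
  have dphix : derivable phi x v.
    by apply/derivable_mxP => i j; rewrite ord1; case: (dphiP j).
  have /derivable1P/derivable1_diffP/differentiable_continuous ch := dphix.
  have : {for 0, continuous h}.
    apply: continuousB; [exact: ch|exact: cst_continuous].
  rewrite /prop_for /continuous_at /h scale0r add0r subrr => ch0.
  by apply: cvg_trans ch0; apply: cvg_app; exact: nbhs_dnbhs.
apply: is_derive_quotient.
have : \sum_(i < n) (s^-1 * h s 0 i) * a i (h s) @[s --> 0^'] -->
    \sum_(i < n) dphi i * 'D_(delta_mx 0 i) f (phi x).
  apply: (cvg_big (op := +%R)) => [|i _]; first exact: add_continuous.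
  apply: cvgM; last exact: cvg_comp h0 (aP i).
  have [d1 <-] := dphiP i; apply: cvg_trans (derive_quotient d1).
  by apply: near_eq_cvg; near=> s; rewrite /h !mxE.
apply: cvg_trans; apply: near_eq_cvg; near=> s => /=.
have E : f (h s + phi x) - f (phi x) = \sum_k h s 0 k * a k (h s).
  by near: s; exact: (h0 _ aE).
rewrite -[phi (s *: v + x)](subrK (phi x)) -/(h s) E mulr_sumr.
by apply: eq_bigr => k _; rewrite mulrA.
Unshelve. all: by end_near. Qed.

End ChainRule.

Section SmoothnessClasses.
Variables (R : realType).

Lemma CkS n k (U V : set 'rV[R]_n) f : V `<=` U -> Ck k U f -> Ck k V f.
Proof.
move=> VU; elim: k f => [|k IH] f [cf df]; split=> //.
- by move=> x /VU; exact: cf.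
- by move=> x /VU; exact: cf.
by move=> i; have [d1 d2] := df i; split; [move=> x /VU; exact: d1|exact: IH].
Qed.

Lemma Ck_continuous n k (U : set 'rV[R]_n) f x :
  Ck k U f -> U x -> {for x, continuous f}.
Proof. by case: k => [|k] [cf _]; exact: cf. Qed.

Lemma Ck_local n k (U : set 'rV[R]_n) f :
  (forall x, U x -> exists2 V, V x & Ck k V f) -> Ck k U f.
Proof.
elim: k f => [|k IH] f Uf; split => //.
- by move=> x /Uf[V Vx [cf _]]; exact: cf.
- by move=> x /Uf[V Vx [cf _]]; exact: cf.
move=> i; split=> [x /Uf[V Vx [_ df]]|]; first exact: (df i).1.
by apply: IH => x /Uf[V Vx [_ df]]; exists V => //; exact: (df i).2.
Qed.

Lemma is_derive_coord n (x v : 'rV[R]_n) (j : 'I_n) :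
  is_derive x v (fun z : 'rV[R]_n => z 0 j) (v 0 j).
Proof.
apply: is_derive_quotient; apply: cvg_near_cst; near=> s.
by rewrite !mxE /= addrK mulKf //; near: s; exact: nbhs_dnbhs_neq.
Unshelve. all: by end_near. Qed.

Lemma Ck_coord n k (U : set 'rV[R]_n) (j : 'I_n) :
  open U -> Ck k U (fun x => x 0 j).
Proof.
move=> oU; case: k => [|k]; split => //.
- by move=> x _; exact: coord_continuous.
- by move=> x _; exact: coord_continuous.
move=> i; have D x := is_derive_coord x (delta_mx 0 i) j.
split=> [x _|]; first by have [] := D x.
apply: (eq_Ck oU _ (Ck_cst oU k (delta_mx 0 i 0 j))) => x _.
by have [_ ->] := D x.
Qed.

Lemma Ck_sum n k (U : set 'rV[R]_n) (I : Type) (r : seq I) (F : I -> 'rV[R]_n -> R) :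
  open U -> (forall i, Ck k U (F i)) -> Ck k U (fun x => \sum_(i <- r) F i x).
Proof.
move=> oU CF; elim: r => [|i r IH].
  by apply: eq_Ck (Ck_cst oU k 0) => // x _; rewrite /= big_nil.
apply: eq_Ck (CkD oU (CF i) IH) => // x _.
by rewrite /= big_cons.
Qed.

Lemma Ck_inv n k (U : set 'rV[R]_n) (f : 'rV[R]_n -> R) :
  open U -> (forall x, U x -> f x != 0) -> Ck k U f -> Ck k U (fun x => (f x)^-1).
Proof.
move=> oU f0; elim: k => [|k IH] Cf; have [cf df] := Cf; split=> //.
- by move=> x Ux; apply: continuousV; [exact: f0|exact: cf].
- by move=> x Ux; apply: continuousV; [exact: f0|exact: cf].
move=> i; have [d1 d2] := df i; split=> [x Ux|].
  exact: derivableV (f0 x Ux) (d1 x Ux).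
have Cfi := IH (CkW Cf).
apply: eq_Ck (CkM oU (Ck_cst oU k (-1)) (CkM oU (CkM oU Cfi Cfi) d2)) => // x Ux.
have := deriveV (f0 x Ux) (d1 x Ux); rewrite /GRing.inv /= => ->.
rewrite mulN1r.
 by rewrite scaleNr -invfM -expr2 .
Qed.

Lemma row_continuous (T : topologicalType) n (phi : T -> 'rV[R]_n) x :
  (forall i, {for x, continuous (fun y => phi y 0 i)}) ->
  {for x, continuous phi}.
Proof.
move=> cphi; apply/cvg_ballP => e e0.
have : \forall y \near x, forall i : 'I_n, ball (phi x 0 i) e (phi y 0 i).
  by apply: filter_forall => i; exact: (cvg_ballP _ _).1 (cphi i) e e0.
by apply: filterS => y ye; split=> // i j; rewrite ord1; exact: ye.
Qed.

(** By the chain rule the partial derivatives of [f \o phi] are sums of products of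
    the partial derivatives of [phi] with compositions of lower class. *)
Lemma Ck_comp m n k (U : set 'rV[R]_m) (V : set 'rV[R]_n)
    (f : 'rV[R]_n -> R) (phi : 'rV[R]_m -> 'rV[R]_n) :
  open U -> open V -> (forall i, Ck k U (fun x => phi x 0 i)) ->
  (forall x, U x -> V (phi x)) -> Ck k V f -> Ck k U (f \o phi).
Proof.
move=> oU oV; elim: k f => [|k IH] f Cphi UV Cf; have [cf df] := Cf.
  split=> // x Ux; apply: continuous_comp; last exact/cf/UV.
  by apply: row_continuous => i; have [c _] := Cphi i; exact: c.
split=> [x Ux|j].
  apply: continuous_comp; last exact/cf/UV.
  by apply: row_continuous => i; have [c _] := Cphi i; exact: c.
have Cf1 : Ck 1 V f.
  split=> // i; have [d1 d2] := df i; split; last split.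
  - exact: d1.
  - by move=> x; exact: Ck_continuous d2.
  - by [].
have D x : U x -> is_derive x (delta_mx 0 j) (f \o phi)
   (\sum_(i < n) 'D_(delta_mx 0 j) (fun y => phi y 0 i) x *
                 'D_(delta_mx 0 i) f (phi x)).
  move=> Ux; apply: (is_derive_C1_comp oV Cf1 (UV x Ux)) => i.
  by have [_ /(_ j)[d1 _]] := Cphi i; exact: derivableP (d1 x Ux).
split=> [x /D[]//|].
apply: (eq_Ck oU (f := fun x => \sum_(i < n) 'D_(delta_mx 0 j) (fun y => phi y 0 i) x *
                 ('D_(delta_mx 0 i) f \o phi) x)) => [x /D[_ ->]//|].
apply: Ck_sum => // i; apply: CkM => //.
  by have [_ /(_ j)[]] := Cphi i.
by apply: IH => //; [move=> l; exact: CkW|exact: (df i).2].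
Qed.

Lemma Cinf_partial n (U : set 'rV[R]_n) f (i : 'I_n) :
  Cinf U f -> Cinf U ('D_(delta_mx 0 i) f).
Proof. by move=> Cf k; have [_ /(_ i)[]] := Cf k.+1. Qed.

End SmoothnessClasses.

(** * A smooth bump *)

Section FlatFunctions.
Variable R : realType.
Implicit Types (t : R) (k : nat).

(** [flat 0] is the flat function [exp (-1/t)]; the derivative of [flat k] is a
    combination of [flat k.+1] and [flat k.+2], so the family makes smoothness
    an induction over all [k] at once. *)
Definition flat k t : R := if 0 < t then t^-1 ^+ k * expR (- t^-1) else 0.

(** One more term of the exponential series at [1/t] beats [t ^ -k]. *)
Lemma flat_le k t : `|flat k t| <= (k.+1)`!%:R * `|t|.
Proof.
rewrite /flat; case: ifPn => [t0|_]; last by rewrite normr0 mulr_ge0.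
rewrite ger0_norm ?mulr_ge0 ?expR_ge0 ?exprn_ge0 ?invr_ge0 ?(ltW t0) //.
rewrite (gtr0_norm t0) expRN ler_pdivrMr ?expR_gt0 //.
have := expR_ge1Dxn k (_ : 0 <= t^-1); rewrite invr_ge0 (ltW t0) => /(_ isT).
move=> /(le_trans (_ : t^-1 ^+ k.+1 / (k.+1)`!%:R <= _)).
rewrite lerDr ler01 => /(_ isT).
rewrite ler_pdivrMr ?ltr0n ?fact_gt0 // exprSr => h.
rewrite -(ler_pM2r (_ : 0 < t^-1)) ?invr_gt0 //; apply: le_trans h _.
by rewrite mulrC mulrAC mulfK ?gt_eqF // mulrC.
Qed.

Lemma is_derive_flat k t :
  is_derive t 1 (flat k) (flat k.+2 t - k%:R * flat k.+1 t).
Proof.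
have [t0|t0|->] := ltgtP t 0.
- have E : {near t, cst 0 =1 flat k}.
    near=> s; rewrite /flat ltNge [s <= 0]ltW //.
    by near: s; exact: lt_nbhsl.
  apply: (near_eq_is_derive E); apply: is_derive_eq.
  by rewrite /flat !ltNge (ltW t0) /= mulr0 subrr.
- pose V (s : R) : R := s^-1.
  have E : {near t, V ^+ k * (expR \o (- V)) =1 flat k}.
    near=> s; rewrite /flat; have -> : 0 < s by near: s; exact: lt_nbhsr.
    by rewrite !fctE.
  have dV : is_derive t 1 V (- t^-1 ^+ 2).
    have := @is_deriveV R id t 1 1 (lt0r_neq0 t0) (is_derive_id _ _).
    by rewrite exprVn [_ *: _]mulr1.
  apply: (near_eq_is_derive E); rewrite /flat t0; apply: is_derive_eq.
  rewrite -/(V t) !fctE /=.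
  have alg (v w : R) : v ^+ k * (w * - - v ^+ 2) +
      w * (k%:R * v ^+ k.-1 * - v ^+ 2) =
      v ^+ k.+2 * w - k%:R * (v ^+ k.+1 * w).
    by case: k {E} => [|k] /=; rewrite !exprS ?expr0; ring.
  exact: alg.
(* At 0 the difference quotient of [flat k] is [flat k.+1]. *)
- have E0 : flat k.+2 0 - k%:R * flat k.+1 0 = 0.
    by rewrite /flat ltxx mulr0 subrr.
  rewrite E0; have E1 : flat k 0 = 0 by rewrite /flat ltxx.
  have : flat k.+1 s @[s --> (0 : R)^'] --> (0 : R).
    apply/cvgrPdist_le => e e0; near=> s.
    rewrite sub0r normrN; apply: le_trans (flat_le _ _) _.
    rewrite mulrC -ler_pdivlMr ?ltr0n ?fact_gt0 //.
    near: s; apply: dnbhs0_le; by rewrite divr_gt0 ?ltr0n ?fact_gt0.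
  move=> h.
  suff : s^-1 *: (flat k (s *: 1 + 0) - flat k 0) @[s --> (0 : R)^'] --> (0 : R).
    by move=> h'; apply: DeriveDef; [apply/cvg_ex; exists 0|exact: cvg_lim].
  apply: cvg_trans h; apply: near_eq_cvg; near=> s => /=.
  rewrite E1 subr0 addr0 [s%:A]mulr1 /flat; case: ifP => _; last by rewrite scaler0.
  by rewrite exprS -mulrA.
Unshelve. all: by end_near. Qed.

Lemma continuous_flat k : continuous (flat k).
Proof.
move=> t; apply: differentiable_continuous; apply/derivable1_diffP.
by have [] := is_derive_flat k t.
Qed.

Lemma Ck_flat n m k (U : set 'rV[R]_n) (q : 'rV[R]_n -> R) :
  open U -> Cinf U q -> Ck m U (flat k \o q).
Proof.
move=> oU Cq; elim: m k => [|m IH] k.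
  split=> // x Ux; apply: continuous_comp; last exact: continuous_flat.
  exact: Ck_continuous (Cq 0%N) Ux.
split=> [x Ux|i].
  apply: continuous_comp; last exact: continuous_flat.
  exact: Ck_continuous (Cq 0%N) Ux.
have D x : U x -> is_derive x (delta_mx 0 i) (flat k \o q)
   ('D_(delta_mx 0 i) q x * (flat k.+2 (q x) - k%:R * flat k.+1 (q x))).
  move=> Ux; have [_ /(_ i)[/(_ x Ux) dq _]] := Cq 1%N.
  have E : 0 *: delta_mx 0 i + x = x by rewrite scale0r add0r.
  apply: is_derive_line0; rewrite mulrC; apply: is_derive1_comp.
    by rewrite E; exact: is_derive_flat.
  by rewrite -[in 'D_(_) _ x]E; apply: is_derive_line; rewrite E.
split=> [x /D[]//|].
apply: (eq_Ck oU (f := fun x => 'D_(delta_mx 0 i) q x *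
   ((flat k.+2 \o q) x + (- k%:R) * (flat k.+1 \o q) x))) => [x /D[_ ->]//|].
  by rewrite mulNr.
apply: CkM => //; first exact: Cinf_partial.
by apply: CkD => //; apply: CkM => //; exact: Ck_cst.
Qed.

End FlatFunctions.

(** * Hadamard's lemma *)

Section UnitIntegral.
Variable R : realType.
Implicit Types f g : R -> R.

Definition integral01 f : R := \int[@lebesgue_measure R]_(t in `[0, 1]) f t.

Definition continuous01 f : Prop :=
  forall t : R, 0 <= t <= 1 -> {for t, continuous f}.

Lemma continuous01_within f : continuous01 f -> {within `[0, 1], continuous f}.
Proof.
move=> cf; apply: continuous_in_subspaceT => t.
by rewrite inE /= in_itv /=; exact: cf.
Qed.

Lemma continuous01_integrable f : continuous01 f ->
  (@lebesgue_measure R).-integrable `[0, 1] (EFin \o f).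
Proof.
move=> cf; apply: continuous_compact_integrable; first exact: segment_compact.
exact: continuous01_within.
Qed.

Lemma lebesgue_measure01 : fine (@lebesgue_measure R `[0, 1]) = 1.
Proof. by rewrite lebesgue_measure_itv /= lte_fin ltr01 sube0. Qed.

Lemma eq_integral01 f g : (forall t, 0 <= t <= 1 -> f t = g t) ->
  integral01 f = integral01 g.
Proof.
move=> fg; apply: eq_Rintegral => t; rewrite inE /= in_itv /=; exact: fg.
Qed.

Lemma integral01_cst (a : R) : integral01 (cst a) = a.
Proof.
by rewrite /integral01 Rintegral_cst ?lebesgue_measure01 ?mulr1.
Qed.

Lemma integral01B f g : continuous01 f -> continuous01 g ->
  integral01 (fun t => f t - g t) = integral01 f - integral01 g.
Proof.
move=> cf cg; rewrite /integral01 RintegralB //; exact: continuous01_integrable.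
Qed.

Lemma integral01D f g : continuous01 f -> continuous01 g ->
  integral01 (fun t => f t + g t) = integral01 f + integral01 g.
Proof.
move=> cf cg; rewrite /integral01 RintegralD //; exact: continuous01_integrable.
Qed.

Lemma integral01Z (a : R) f : continuous01 f ->
  integral01 (fun t => a * f t) = a * integral01 f.
Proof.
move=> cf; rewrite /integral01 RintegralZl //; exact: continuous01_integrable.
Qed.

Lemma continuous01B f g : continuous01 f -> continuous01 g ->
  continuous01 (fun t => f t - g t).
Proof. by move=> cf cg t t01; apply: continuousB; [exact: cf|exact: cg]. Qed.

Lemma continuous01M f g : continuous01 f -> continuous01 g ->
  continuous01 (fun t => f t * g t).
Proof. by move=> cf cg t t01; apply: continuousM; [exact: cf|exact: cg]. Qed.

Lemma integral01_sum (I : Type) (r : seq I) (F : I -> R -> R) :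
  (forall i, continuous01 (F i)) ->
  continuous01 (fun t => \sum_(i <- r) F i t) /\
  integral01 (fun t => \sum_(i <- r) F i t) = \sum_(i <- r) integral01 (F i).
Proof.
move=> cF; elim: r => [|i r [IHc IH]].
  have -> : (fun t => \sum_(i <- [::]) F i t) = cst 0.
    by apply/funext => t; rewrite big_nil.
  by rewrite big_nil integral01_cst; split => // t _; exact: cst_continuous.
have -> : (fun t => \sum_(j <- i :: r) F j t) =
    (fun t => F i t + \sum_(j <- r) F j t).
  by apply/funext => t; rewrite big_cons.
rewrite big_cons integral01D // IH; split=> // t t01.
by apply: continuousD; [exact: cF|exact: IHc].
Qed.

Lemma integral01_close f g (e : R) : continuous01 f -> continuous01 g ->
  (forall t, 0 <= t <= 1 -> `|f t - g t| <= e) ->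
  `|integral01 f - integral01 g| <= e.
Proof.
move=> cf cg fge; have cfg := continuous01B cf cg; rewrite -integral01B //.
apply: le_trans (le_normr_Rintegral _ (continuous01_integrable cfg)) _ => //.
rewrite -[leRHS]integral01_cst; apply: le_Rintegral => //.
- apply: (continuous01_integrable (f := fun t => `|f t - g t|)) => t t01.
  exact: cvg_norm (cfg t t01).
- by apply: continuous01_integrable => t _; exact: cst_continuous.
Qed.

Lemma integral01_FTC (F f : R -> R) : continuous01 f ->
  (forall t : R, 0 <= t <= 1 -> is_derive t 1 F (f t)) ->
  integral01 f = F 1 - F 0.
Proof.
move=> cf dF.
have cF t : 0 <= t <= 1 -> {for t, continuous F}.
  move=> /dF[d _]; apply: differentiable_continuous.
  exact/derivable1_diffP.
rewrite /integral01 /Rintegral (@continuous_FTC2 _ _ F) ?ltr01 //.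
- exact: continuous01_within.
- split=> [t| |].
  + by rewrite in_itv /= => /andP[/ltW t0 /ltW t1]; have [|//] := dF t; rewrite t0.
  + by apply: cvg_at_right_filter; apply: cF; rewrite lexx ler01.
  + by apply: cvg_at_left_filter; apply: cF; rewrite lexx ler01.
- move=> t; rewrite in_itv /= => /andP[/ltW t0 /ltW t1].
  by have [|_] := dF t; rewrite ?t0 // derive1E.
Qed.

End UnitIntegral.

Section Hadamard.
Variables (R : realType) (n : nat) (V : set 'rV[R]_n) (y : 'rV[R]_n).
Implicit Types (u : 'rV[R]_n -> R) (x : 'rV[R]_n) (m : nat).

Definition ray x (t : R) : 'rV[R]_n := t *: (x - y) + y.

Hypothesis oV : open V.
Hypothesis starV : forall x (t : R), V x -> 0 <= t <= 1 -> V (ray x t).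

(** Averages of [u] along the segments issued from [y]; the weight [t ^ m]
    makes the family stable under partial derivatives, each of which brings a
    factor [t]. *)
Definition ray_mean m u x : R := integral01 (fun t => t ^+ m * u (ray x t)).

Lemma ray_translate x v t : ray (v + x) t = t *: v + ray x t.
Proof. by rewrite /ray -addrA scalerDr addrA. Qed.

Lemma ray_continuous x : continuous (ray x).
Proof.
move=> t; apply: cvgD; last exact: cvg_cst.
by apply: cvgZ; [exact: cvg_id|exact: cvg_cst].
Qed.

Lemma continuous01_ray m u x : (forall z, V z -> {for z, continuous u}) ->
  V x -> continuous01 (fun t => t ^+ m * u (ray x t)).
Proof.
move=> cu Vx t t01; apply: continuousM; first exact: exprn_continuous.
apply: continuous_comp; first exact: ray_continuous.
exact/cu/starV.
Qed.

(** Compactness of the segment makes the continuity of [u] uniform along it. *)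
Lemma ray_uniform u x (e : R) : (forall z, V z -> {for z, continuous u}) ->
  V x -> 0 < e ->
  \forall x' \near x, V x' /\
    forall t, 0 <= t <= 1 -> `|u (ray x' t) - u (ray x t)| <= e.
Proof.
move=> cu Vx e0; apply: filterI; first exact: open_nbhs_nbhs.
suff H : forall t : R, `[0, 1]%classic t -> \forall t' \near t & x' \near x,
    `|u (ray x' t') - u (ray x t')| <= e.
  have cov := (compact_near_coveringP _).1 (@segment_compact R 0 1).
  have := cov _ (nbhs x) (fun x' t => `|u (ray x' t) - u (ray x t)| <= e)
    (nbhs_filter x) H.
  by apply: filterS => x' h t t01; apply: (h t); rewrite /= in_itv.
move=> t; rewrite /= in_itv /= => t01.
have cR : {for (t, x), continuous (fun p : R * 'rV[R]_n => ray p.2 p.1)}.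
  apply: cvgD; last exact: cvg_cst.
  apply: cvgZ; first exact: cvg_fst.
  by apply: cvgB; [exact: cvg_snd|exact: cvg_cst].
have cR' : {for (t, x), continuous (fun p : R * 'rV[R]_n => ray x p.1)}.
  apply: continuous_comp; [exact: cvg_fst|exact: ray_continuous].
have : {for (t, x), continuous
    (fun p : R * 'rV[R]_n => u (ray p.2 p.1) - u (ray x p.1))}.
  apply: continuousB; apply: continuous_comp => //; exact/cu/starV.
rewrite /prop_for /continuous_at /= subrr => /cvgrPdist_le /(_ e e0).
by apply: filterS => p; rewrite sub0r normrN.
Qed.

Lemma ray_mean_continuous m u x : (forall z, V z -> {for z, continuous u}) ->
  V x -> {for x, continuous (ray_mean m u)}.
Proof.
move=> cu Vx; apply/(@cvgrPdist_le _ _ _ (nbhs x) (nbhs_filter x)) => e e0.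
apply: filterS (ray_uniform cu Vx e0) => x' [Vx' ux'].
rewrite distrC; apply: integral01_close; [exact: continuous01_ray..|].
move=> t t01; rewrite -mulrBr normrM -[leRHS]mul1r ler_pM //; last exact: ux'.
move: t01 => /andP[t0 t1].
by rewrite normrX ger0_norm // exprn_ile1.
Qed.

(** The mean value theorem turns the difference quotient of the integrand into
    [t ^ m.+1] times a value of the partial derivative at a nearby ray, and
    [ray_uniform] bounds the change of ray uniformly in [t]. *)
Lemma is_derive_ray_mean m u x (i : 'I_n) : Ck 1 V u -> V x ->
  is_derive x (delta_mx 0 i) (ray_mean m u)
    (ray_mean m.+1 ('D_(delta_mx 0 i) u) x).
Proof.
move=> [cu du] Vx; have [d1 [cdu _]] := du i.
apply: is_derive_quotient; apply/cvgrPdist_le => e e0.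
have /nbhs_ballP[d /= d0 dP] := ray_uniform cdu Vx e0.
near=> s.
have s0 : s != 0 by near: s; exact: nbhs_dnbhs_neq.
have sd : `|s| < d by near: s; exact: dnbhs0_lt.
have near_x (r : R) : `|r| <= `|s| -> ball x d (r *: delta_mx 0 i + x).
  move=> rs; rewrite -ball_normE /ball_ /= opprD addrCA subrr addr0 normrN.
  apply: le_lt_trans sd; apply: le_trans rs; rewrite normrZ.
  rewrite ler_piMr //; apply: row_norm_le => // j.
  by rewrite mxE; case: (_ && _); rewrite ?normr1 ?normr0.
have Vr r : `|r| <= `|s| -> V (r *: delta_mx 0 i + x) by move=> /near_x/dP[].
have c1 := @continuous01_ray m u x cu Vx.
have c2 := @continuous01_ray m u _ cu (Vr s (lexx _)).
rewrite distrC /ray_mean -integral01B // -integral01Z; last exact: continuous01B.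
apply: integral01_close.
- by apply: continuous01M; [move=> t _; exact: cst_continuous|exact: continuous01B].
- exact: (@continuous01_ray m.+1 _ x cdu Vx).
move=> t t01; have /andP[t0 t1] := t01.
have rs (r : R) : 0 <= r <= 1 -> `|r * s| <= `|s|.
  by move=> /andP[r0 r1]; rewrite normrM (ger0_norm r0) ler_piMl.
have [|r r01 E] := @MVT_line R n u (ray x t) (delta_mx 0 i) (t * s).
  move=> r r01; apply: d1; rewrite mulrCA -scalerA -ray_translate.
  by apply: starV t01; exact/Vr/rs.
rewrite ray_translate scalerA -mulrBr E.
rewrite mulrCA [t * s]mulrC -!mulrA mulKf // [t ^+ m * _]mulrA -exprSr -mulrBr.
rewrite normrM normrX (ger0_norm t0) -[leRHS]mul1r ler_pM ?exprn_ge0 //.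
  by rewrite exprn_ile1.
rewrite [s * t]mulrC [r * _]mulrCA -scalerA -ray_translate.
by have [_] := dP _ (near_x _ (rs r r01)); apply.
Unshelve. all: by end_near. Qed.

Lemma Ck_ray_mean k m u : Cinf V u -> Ck k V (ray_mean m u).
Proof.
elim: k m u => [|k IH] m u Cu; (split; first by
  move=> x Vx; apply: ray_mean_continuous => // z; exact: Ck_continuous (Cu 0%N)) => //.
move=> i; have D x : V x -> _ := @is_derive_ray_mean m u x i (Cu 1%N).
split=> [x /D[]//|].
apply: (eq_Ck oV (f := ray_mean m.+1 ('D_(delta_mx 0 i) u))) => [x /D[_ ->]//|].
exact/IH/Cinf_partial.
Qed.

(** [u x - u y] is the integral of the derivative of [u] along the segment from
    [y] to [x], which is linear in [x - y]. *)
Lemma Hadamard u : V y -> Cinf V u ->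
  exists h : 'I_n -> 'rV[R]_n -> R,
    [/\ forall i, Cinf V (h i), forall i, h i y = 'D_(delta_mx 0 i) u y &
        forall x, V x -> u x = u y + \sum_(i < n) (x 0 i - y 0 i) * h i x].
Proof.
move=> Vy Cu; exists (fun i => ray_mean 0 ('D_(delta_mx 0 i) u)); split.
- by move=> i k; apply/Ck_ray_mean/Cinf_partial.
- move=> i; rewrite /ray_mean -[RHS]integral01_cst; apply: eq_integral01 => t _.
  by rewrite expr0 mul1r /ray subrr scaler0 add0r.
move=> x Vx.
have cD i : continuous01 (fun t => t ^+ 0 * 'D_(delta_mx 0 i) u (ray x t)).
  have cDu z : V z -> {for z, continuous ('D_(delta_mx 0 i) u)}.
    exact: Ck_continuous (Cinf_partial i Cu 0%N).
  exact: (@continuous01_ray 0 _ x cDu Vx).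
have cD' i : continuous01 (fun t => (x 0 i - y 0 i) *
    (t ^+ 0 * 'D_(delta_mx 0 i) u (ray x t))).
  by apply: continuous01M => // t _; exact: cst_continuous.
have [cS IS] := integral01_sum (index_enum 'I_n) cD'.
have : integral01 (fun t => \sum_(i < n) (x 0 i - y 0 i) *
    (t ^+ 0 * 'D_(delta_mx 0 i) u (ray x t))) = u (ray x 1) - u (ray x 0).
  apply: (integral01_FTC (F := u \o ray x)) cS _ => t t01.
  have Vt := starV Vx t01.
  have D : is_derive (ray x t) (x - y) u
      (\sum_(i < n) (x - y) 0 i * 'D_(delta_mx 0 i) u (ray x t)).
    apply: (is_derive_C1_comp (phi := id) oV (Cu 1%N) Vt) => i.
    exact: is_derive_coord.
  apply: (is_derive_eq (is_derive_line _)); first by have [] := D.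
  have [_ ->] := D; apply: eq_bigr => i _.
  by rewrite expr0 mul1r !mxE.
rewrite IS /ray scale1r subrK scale0r add0r => E.
rewrite -[LHS](subrK (u y)) -E addrC; congr (_ + _).
by apply: eq_bigr => i _; rewrite integral01Z.
Qed.

End Hadamard.

(** * Bumps and functions supported in a chart *)

Section Bump.
Variables (R : realType) (n : nat).

(** Balls are star-shaped about each of their points, which is what makes
    Hadamard's lemma available at every point where the bump does not vanish. *)
Lemma ball_star (a x y : 'rV[R]_n) (e t : R) : `|x - a| < e -> `|y - a| < e ->
  0 <= t <= 1 -> `|ray y x t - a| < e.
Proof.
move=> xe ye /andP[t0 t1].
have -> : ray y x t - a = t *: (x - a) + (1 - t) *: (y - a).
  apply/rowP => i; rewrite !mxE; ring.
apply: le_lt_trans (ler_normD _ _) _; rewrite !normrZ (ger0_norm t0).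
rewrite (@ger0_norm _ (1 - t)) ?subr_ge0 //.
have [->|t_neq0] := eqVneq t 0; first by rewrite mul0r add0r subr0 mul1r.
have t_gt0 : 0 < t by rewrite lt_def t_neq0.
rewrite [ltRHS](_ : e = t * e + (1 - t) * e); last by ring.
by rewrite ltr_leD ?ltr_pM2l // ler_wpM2l ?subr_ge0 // ltW.
Qed.

(** [V] is a ball for the sup norm, and the bump is [flat 0] applied to
    [(e/2)^2 - |x - a|^2] with the Euclidean norm, which is polynomial; it lives in
    a compact set [K] strictly inside [V]. *)
Lemma exists_bump (U : set 'rV[R]_n) a : open U -> U a ->
  exists (V K : set 'rV[R]_n) (b : 'rV[R]_n -> R),
    [/\ [/\ open V, V `<=` U & V a],
        forall x y t, V x -> V y -> 0 <= t <= 1 -> V (ray y x t),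
        K `<=` V /\ compact K &
        [/\ Cinf V b, forall x, ~ K x -> b x = 0 & b a != 0]].
Proof.
move=> oU Ua; have [e e0 eU] := open_ball_norm oU Ua.
pose V := [set x : 'rV[R]_n | `|x - a| < e].
pose q (x : 'rV[R]_n) :=
  (e / 2) ^+ 2 - \sum_(i < n) (x 0 i - a 0 i) * (x 0 i - a 0 i).
pose K := [set x | 0 <= q x].
have oV : open V.
  have -> : V = ball a e.
    by apply/seteqP; split=> x; rewrite -ball_normE /ball_ /= distrC.
  exact: ball_open.
have oT : open [set: 'rV[R]_n] by exact: openT.
have Cq : Cinf setT q.
  move=> k; apply: eq_Ck (CkD oT (Ck_cst oT k ((e / 2) ^+ 2)) (CkM oT (Ck_cst oT k (-1))
    (Ck_sum (index_enum 'I_n) oT (fun i => CkM oT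
      (CkD oT (Ck_coord k i oT) (Ck_cst oT k (- a 0 i)))
      (CkD oT (Ck_coord k i oT) (Ck_cst oT k (- a 0 i))))))) => // x _.
  by rewrite mulN1r.
have Kle x : K x -> `|x - a| <= e / 2.
  rewrite /K /= subr_ge0 => le_q; apply: row_norm_le; first by rewrite divr_ge0 // ltW.
  move=> j; rewrite -(@ler_pXn2r _ 2) ?nnegrE ?divr_ge0 ?(ltW e0) //.
  apply: le_trans le_q; rewrite -normrX !mxE ger0_norm ?sqr_ge0 // expr2.
  rewrite (bigD1 j) //= lerDl; apply: sumr_ge0 => i _.
  by rewrite -expr2 sqr_ge0.
have KV : K `<=` V.
  move=> x /Kle xe; apply: le_lt_trans xe _.
  by rewrite ltr_pdivrMr // ltr_pMr // ltr1n.
have cq : continuous q by move=> x; exact: Ck_continuous (Cq 0%N) I.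
exists V, K, (flat 0 \o q); split.
- split=> //; last by rewrite /V /= subrr normr0.
- by move=> x y t; exact: ball_star.
- split=> //; apply: bounded_closed_compact.
    exists (`|a| + e / 2); split; first exact: num_real.
    move=> M hM x /Kle xe; apply: le_trans (ltW hM).
    rewrite -[x](subrK a) addrC; apply: le_trans (ler_normD _ _) _.
    by rewrite lerD2l.
  have -> : K = q @^-1` [set r | 0 <= r] by [].
  by apply: closed_comp; [move=> x _; exact: cq|exact: closed_ge].
- split.
  + by move=> k; apply: CkS (Ck_flat k 0 oT Cq).
  + by move=> x Kx /=; rewrite /flat ifF //; apply/negP => /ltW.
  rewrite /= /flat /q; under eq_bigr do rewrite subrr mul0r.
  rewrite big1_eq subr0 exprn_gt0 ?divr_gt0 // expr0 mul1r.
  by rewrite gt_eqF // expR_gt0.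
Qed.

End Bump.

Section Extension.
Variables (R : realType) (n : nat) (M : smooth_manifold R n).
Implicit Types (c d : chart R M n) (O : set M) (u : 'rV[R]_n -> R).

Lemma chart_inv_dom c x : (c @` chart_dom c) x ->
  chart_dom c (chart_inv c x) /\ c (chart_inv c x) = x.
Proof. by move=> [q cq <-]; rewrite (chart_funK c) ?inE. Qed.

Lemma open_chart_image c O : open O -> open (c @` (chart_dom c `&` O)).
Proof.
move=> oO; rewrite openE => x [q [cq Oq] <-]; rewrite /interior.
have ccq : (c @` chart_dom c) (c q) by exists q.
have cinv := chart_inv_continuous c (c q) (mem_set ccq).
have n1 : nbhs (c q) (c @` chart_dom c).
  by apply: open_nbhs_nbhs; split=> //; exact: chart_img_open.
have n2 : nbhs (c q) (chart_inv c @^-1` O).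
  apply: cinv; apply: open_nbhs_nbhs; split=> //.
  by rewrite (chart_funK c) ?inE.
apply: filterS (filterI n1 n2) => z [/chart_inv_dom[iz cz] Oz].
by exists (chart_inv c z).
Qed.

Lemma open_chart_preimage c (V : set 'rV[R]_n) :
  open V -> open (chart_dom c `&` c @^-1` V).
Proof.
move=> oV; rewrite openE => q [cq Vq]; rewrite /interior.
apply: filterI; first by apply: open_nbhs_nbhs; split=> //; exact: chart_dom_open.
by apply: (chart_fun_continuous c q (mem_set cq)); exact: open_nbhs_nbhs.
Qed.

Definition extend c (V : set 'rV[R]_n) u : M -> R :=
  fun q => if `[< chart_dom c q /\ V (c q) >] then u (c q) else 0.

Lemma extendE c (V : set 'rV[R]_n) u q :
  chart_dom c q -> V (c q) -> extend c V u q = u (c q).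
Proof. by move=> cq Vq; rewrite /extend ifT //; apply/asboolP. Qed.

Lemma extend_out c (V : set 'rV[R]_n) u q :
  ~ (chart_dom c q /\ V (c q)) -> extend c V u q = 0.
Proof. by move=> h; rewrite /extend ifF //; apply/asboolP. Qed.

(** The Hausdorff property enters here: the compact support is closed in [M], so
    the extension is smooth across the boundary of the chart. *)
Lemma extend_smooth c (V K : set 'rV[R]_n) u : mfd_atlas c -> open V ->
  V `<=` c @` chart_dom c -> K `<=` V -> compact K -> Cinf V u ->
  (forall x, ~ K x -> u x = 0) -> extend c V u \in smooth_pred M.
Proof.
move=> cM oV Vc KV cK Cu u0; apply/asboolP => d dM k.
apply: Ck_local => x [q dq <-].
(* It suffices to find, near [q], an expression of the extension read in [d]. *)
have W_Ck O g : open O -> O q -> Ck k (d @` (chart_dom d `&` O)) g ->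
    (forall z, chart_dom d z -> O z -> g (d z) = extend c V u z) ->
    exists2 W, W (d q) & Ck k W (extend c V u \o chart_inv d).
  move=> oO Oq Cg gE; exists (d @` (chart_dom d `&` O)); first by exists q.
  apply: eq_Ck Cg; first exact: open_chart_image.
  by move=> _ [z [dz Oz] <-]; rewrite /= (chart_funK d) ?inE // gE.
have [[cq Vq]|nq] := pselect (chart_dom c q /\ V (c q)).
  apply: (W_Ck (chart_dom c `&` c @^-1` V) (u \o (fun x => c (chart_inv d x)))) => //.
  - exact: open_chart_preimage.
  - apply: (Ck_comp (V := V)) => //.
    + exact/open_chart_image/open_chart_preimage.
    + move=> i; apply: CkS (mfd_compat M d c dM cM i k).
      by apply: image_subset => z [dz [cz _]].
    + by move=> _ [z [dz [cz Vz]] <-]; rewrite (chart_funK d) ?inE.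
  - by move=> z dz [cz Vz]; rewrite /= (chart_funK d) ?inE // extendE.
have oK : open (~` (chart_inv c @` K)).
  apply: closed_openC; apply: (compact_closed (mfd_hausdorff M)).
  apply: continuous_compact cK; apply: continuous_in_subspaceT => z.
  by rewrite inE => /KV/Vc zc; apply: chart_inv_continuous; rewrite inE.
apply: (W_Ck (~` (chart_inv c @` K)) (fun=> 0) oK).
- move=> [z Kz E]; apply: nq; rewrite -E.
  have [h ->] := chart_inv_dom (Vc _ (KV _ Kz)).
  by split; [exact: h|exact: (KV _ Kz)].
- by apply: Ck_cst; exact: open_chart_image.
- move=> z dz Oz; have [[cz Vz]|nz] := pselect (chart_dom c z /\ V (c z)).
    rewrite extendE // u0 // => Kz; apply: Oz; exists (c z) => //.
    by rewrite (chart_funK c) ?inE.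
  by rewrite extend_out.
Qed.

Lemma smooth_fun_chart c (f : smooth_fun M) : mfd_atlas c ->
  Cinf (c @` chart_dom c) (f \o chart_inv c).
Proof. by move=> cM; have /asboolP := valP f; apply. Qed.

(** Near [p] the function [f] is the quotient [h / d], and smoothness is local. *)
Lemma smooth_local_quotient (f : M -> R) :
  (forall p, exists h d : smooth_fun M, d p != 0 /\ forall q, d q * f q = h q) ->
  f \in smooth_pred M.
Proof.
move=> fP; apply/asboolP => c cM k; apply: Ck_local => x cx.
have [h [d [dx E]]] := fP (chart_inv c x).
have Ch := smooth_fun_chart h cM; have Cd := smooth_fun_chart d cM.
have cO : {in c @` chart_dom c, continuous (d \o chart_inv c)}.
  by move=> z /set_mem cz; exact: Ck_continuous (Cd 0%N) cz.
exists [set z | (c @` chart_dom c) z /\ (d \o chart_inv c) z != 0]; first by [].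
set W := (X in Ck _ X); have oW : open W.
  rewrite openE => z [cz dz]; rewrite /interior.
  apply: filterI; first by apply: open_nbhs_nbhs; split=> //; exact: chart_img_open.
  apply: (cO z (mem_set cz) [set r | r != 0]).
  by apply: open_nbhs_nbhs; split=> //; exact: open_neq.
have WS : W `<=` c @` chart_dom c by move=> z [].
have Cdinv := Ck_inv oW (fun z => @proj2 _ _) (CkS WS (Cd k)).
apply: eq_Ck (CkM oW (CkS WS (Ch k)) Cdinv) => // z [cz dz] /=.
by rewrite -E mulrAC mulfV ?mul1r.
Qed.

End Extension.

(** * Vector fields in a chart *)

Section LocalFrame.
Variables (R : realType) (n : nat) (M : smooth_manifold R n).
Local Notation F := (smooth_fun M).

Lemma smooth_fun_sumE (I : Type) (r : seq I) (f : I -> F) q :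
  (\sum_(i <- r) f i : F) q = \sum_(i <- r) f i q.
Proof.
elim: r => [|i r IH]; first by rewrite !big_nil.
by rewrite !big_cons -IH.
Qed.

Lemma vector_field_ext (X Y : vector_field M) :
  (forall (f : F) q, (X f : F) q = (Y f : F) q) -> X = Y.
Proof.
move=> XY; apply: val_inj; apply/funext => f.
by apply: smooth_fun_ext => q; exact: XY.
Qed.

Lemma vector_field_scaleE (h : F) (X : vector_field M) (f : F) q :
  ((h *: X) f : F) q = h q * (X f : F) q.
Proof. by []. Qed.

Lemma vector_field_addE (X Y : vector_field M) (f : F) q :
  ((X + Y) f : F) q = (X f : F) q + (Y f : F) q.
Proof. by []. Qed.

Lemma vector_field_sumE (I : Type) (r : seq I) (A : I -> F)
    (E : I -> vector_field M) (f : F) q :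
  ((\sum_(i <- r) A i *: E i : vector_field M) f : F) q =
  \sum_(i <- r) A i q * (E i f : F) q.
Proof.
elim: r => [|i r IH]; first by rewrite !big_nil.
by rewrite !big_cons -IH.
Qed.

Lemma vector_field0 (X : vector_field M) : X 0 = 0.
Proof.
have [lX _] := vector_fieldP X.
by have := lX (-1) 0 0; rewrite addr0 scaler0 scaleN1r addNr.
Qed.

Lemma vector_fieldD (X : vector_field M) (f g : F) : X (f + g) = X f + X g.
Proof. by have [lX _] := vector_fieldP X; rewrite -[f]scale1r lX !scale1r. Qed.

Lemma vector_field_sum (X : vector_field M) (I : Type) (r : seq I) (f : I -> F) :
  X (\sum_(i <- r) f i) = \sum_(i <- r) X (f i).
Proof.
elim: r => [|i r IH]; first by rewrite !big_nil vector_field0.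
by rewrite !big_cons vector_fieldD IH.
Qed.

Lemma vector_fieldBZ (X : vector_field M) (f g : F) (a : R) :
  X (f - a *: g) = X f - a *: X g.
Proof.
have [lX _] := vector_fieldP X.
by rewrite addrC -scaleNr lX scaleNr addrC.
Qed.

Lemma vector_field1 (X : vector_field M) : X 1 = 0.
Proof.
have [_ dX] := vector_fieldP X.
by have := dX 1 1; rewrite !mulr1 mul1r -[LHS]addr0 => /addrI.
Qed.

Section BumpedChart.
Variables (c : chart R M n) (V K : set 'rV[R]_n) (b : 'rV[R]_n -> R).
Hypotheses (cM : mfd_atlas c) (oV : open V) (Vc : V `<=` c @` chart_dom c).
Hypothesis starV : forall x y t, V x -> V y -> 0 <= t <= 1 -> V (ray y x t).
Hypotheses (KV : K `<=` V) (cK : compact K).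
Hypotheses (Cb : Cinf V b) (b0 : forall x, ~ K x -> b x = 0).
Implicit Types (u : 'rV[R]_n -> R) (f g : F).

Lemma bump_mul_smooth u (Cu : Cinf V u) :
  extend c V (fun x => b x * u x) \in smooth_pred M.
Proof.
apply: (extend_smooth cM oV Vc KV cK) => [k|x /b0->]; last by rewrite mul0r.
exact: CkM (Cb k) (Cu k).
Qed.

Definition bump_mul u (Cu : Cinf V u) : F := SmoothFun (bump_mul_smooth Cu).

Lemma bump_mulE u (Cu : Cinf V u) q : chart_dom c q -> V (c q) ->
  bump_mul Cu q = b (c q) * u (c q).
Proof. by move=> cq Vq; rewrite /= extendE. Qed.

Lemma bump_mul_out u (Cu : Cinf V u) q : ~ (chart_dom c q /\ V (c q)) ->
  bump_mul Cu q = 0.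
Proof. by move=> h; rewrite /= extend_out. Qed.

Lemma Cinf_read f : Cinf V (f \o chart_inv c).
Proof. by move=> k; exact: CkS (smooth_fun_chart f cM k). Qed.

Let Cpartial f i : Cinf V ('D_(delta_mx 0 i) (f \o chart_inv c)) :=
  Cinf_partial i (Cinf_read f).

Lemma chart_field_subproof (i : 'I_n) :
  (fun f : F => bump_mul (Cpartial f i) : F^o) \in vector_field_pred M.
Proof.
have D (f : F) x : V x -> derivable (f \o chart_inv c) x (delta_mx 0 i).
  by move=> Vx; have [_ /(_ i)[/(_ x Vx)]] := Cinf_read f 1%N.
apply/asboolP; split=> [a f g|f g]; apply: smooth_fun_ext => q;
  (have [[cq Vq]|nq] := pselect (chart_dom c q /\ V (c q)); last by
    rewrite ?smooth_funE !bump_mul_out ?mulr0 ?mul0r ?addr0).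
- rewrite !smooth_funE !bump_mulE //.
  have -> : (a *: f + g)%R \o chart_inv c =
      a *: (f \o chart_inv c) + (g \o chart_inv c) :> ('rV[R]_n -> R) by [].
  have aD : derivable (a *: (f \o chart_inv c)) (c q) (delta_mx 0 i).
    by apply: derivableZ; exact: D.
  rewrite deriveD ?deriveZ; [|exact: D|exact: aD|exact: D].
  have alg (r s t : R) : r * (a * s + t) = a * (r * s) + r * t by ring.
  exact: alg.
- rewrite !smooth_funE !bump_mulE //.
  have -> : (f * g)%R \o chart_inv c =
      (f \o chart_inv c) * (g \o chart_inv c) :> ('rV[R]_n -> R) by [].
  rewrite deriveM; [|exact: D..].
  rewrite /= (chart_funK c) ?inE //.
  have alg (r s t v w : R) : r * (s * t + v * w) = r * w * v + s * (r * t) by ring.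
  exact: alg.
Qed.

(** The bump times a coordinate field, which makes it a field on all of [M]. *)
Definition chart_field i : vector_field M := VectorField (chart_field_subproof i).

Lemma chart_fieldE i f q : chart_dom c q -> V (c q) ->
  (chart_field i f : F) q =
    b (c q) * 'D_(delta_mx 0 i) (f \o chart_inv c) (c q).
Proof. exact: bump_mulE. Qed.

Let C1 : Cinf V (fun=> 1) := fun k => Ck_cst oV k 1.
Let Ccoord i : Cinf V (fun x => x 0 i) := fun k => Ck_coord k i oV.

Definition chart_bump : F := bump_mul C1.
Definition chart_coord i : F := bump_mul (Ccoord i).

Lemma chart_bumpE q : chart_dom c q -> V (c q) -> chart_bump q = b (c q).
Proof. by move=> cq Vq; rewrite [LHS]bump_mulE ?mulr1. Qed.

Lemma chart_coordE i q : chart_dom c q -> V (c q) ->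
  chart_coord i q = b (c q) * c q 0 i.
Proof. exact: bump_mulE. Qed.

(** Multiplying Hadamard's expansion of [f] about [q] by the square of the bump
    turns it into an identity between global functions, to which [X] applies;
    at [q] only the terms where [X] hits a coordinate survive. *)
Lemma chart_field_decomposition (X : vector_field M) :
  chart_bump ^+ 3 *: X = \sum_(i < n)
    (chart_bump * X (chart_coord i) - chart_coord i * X chart_bump) *: chart_field i.
Proof.
apply: vector_field_ext => f q; rewrite vector_field_scaleE vector_field_sumE.
have [[cq Vq]|nq] := pselect (chart_dom c q /\ V (c q)); last first.
  have -> : (chart_bump ^+ 3) q = chart_bump q ^+ 3 by [].
  have -> : chart_bump q = 0 by exact: bump_mul_out.
  rewrite expr0n mul0r big1 // => i _.
  have -> : (chart_field i f : F) q = 0 by exact: bump_mul_out.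
  by rewrite mulr0.
have [h [Ch hy E]] := Hadamard oV (fun x t Vx => starV Vx Vq) Vq (Cinf_read f).
pose G i : F := bump_mul (Ch i).
have id_F : chart_bump * chart_bump * (f - f q *: (1 : F)) =
    \sum_(i < n) (chart_coord i - c q 0 i *: chart_bump) * G i.
  apply: smooth_fun_ext => z; rewrite smooth_fun_sumE.
  have lhs : (chart_bump * chart_bump * (f - f q *: (1 : F))) z =
    chart_bump z * chart_bump z * (f z - f q * 1) by [].
  have rhs i : ((chart_coord i - c q 0 i *: chart_bump) * G i) z =
    (chart_coord i z - c q 0 i * chart_bump z) * G i z by [].
  rewrite lhs (eq_bigr _ (fun i _ => rhs i)).
  have [[cz Vz]|nz] := pselect (chart_dom c z /\ V (c z)); last first.
    have -> : chart_bump z = 0 by exact: bump_mul_out.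
    rewrite !mul0r big1 // => i _.
    have -> : G i z = 0 by exact: bump_mul_out.
    by rewrite mulr0.
  rewrite chart_bumpE // mulr1.
  have -> : f z = f q + \sum_(i < n) (c z 0 i - c q 0 i) * h i (c z).
    by have := E _ Vz; rewrite /= !(chart_funK c) ?inE.
  rewrite addrC addKr mulr_sumr; apply: eq_bigr => i _.
  by rewrite chart_coordE // [G i z]bump_mulE //; ring.
have := congr1 (fun f : F => (X f : F) q) id_F.
rewrite vector_field_sum smooth_fun_sumE.
have [_ dX] := vector_fieldP X.
have -> : (X (chart_bump * chart_bump * (f - f q *: (1 : F))) : F) q =
    chart_bump q * chart_bump q * (X f : F) q.
  rewrite dX vector_fieldBZ vector_field1 !smooth_funE.
  have -> : (- (f q *: (1 : F)) : F) q = - (f q * 1) by [].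
  by rewrite mulr1 subrr mulr0 add0r scaler0 subr0.
have rhs i : (X ((chart_coord i - c q 0 i *: chart_bump) * G i) : F) q =
    ((X (chart_coord i) : F) q - c q 0 i * (X chart_bump : F) q) *
    (chart_field i f : F) q.
  rewrite dX vector_fieldBZ !smooth_funE.
  have -> : (- (c q 0 i *: chart_bump) : F) q = - (c q 0 i * chart_bump q) by [].
  have -> : (- (c q 0 i *: (X chart_bump : F)) : F) q =
    - (c q 0 i * (X chart_bump : F) q) by [].
  rewrite chart_coordE // chart_bumpE // [b _ * _]mulrC subrr mul0r addr0.
  by rewrite [G i q]bump_mulE // hy -chart_fieldE.
rewrite (eq_bigr _ (fun i _ => rhs i)) => XE.
have -> : (chart_bump ^+ 3) q = chart_bump q * (chart_bump q * chart_bump q) by [].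
rewrite -mulrA XE mulr_sumr; apply: eq_bigr => i _; rewrite mulrA; congr (_ * _).
have -> : (chart_bump * X (chart_coord i) - chart_coord i * X chart_bump) q =
  chart_bump q * (X (chart_coord i) : F) q - chart_coord i q * (X chart_bump : F) q by [].
by rewrite chart_coordE // chart_bumpE //; ring.
Qed.

(** The functions [chart_coord j - c q 0 j *: chart_bump] separate the fields:
    [chart_field i] takes at [q] the value [b (c q) ^ 2] on the [i]-th one and 0
    on the others. *)
Lemma chart_field_free (a : 'I_n -> R) q : chart_dom c q -> V (c q) ->
  b (c q) != 0 ->
  (forall f, \sum_(i < n) a i * (chart_field i f : F) q = 0) -> forall i, a i = 0.
Proof.
move=> cq Vq bq aE j.
have D i : (chart_field i (chart_coord j - c q 0 j *: chart_bump) : F) q =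
    b (c q) ^+ 2 * (i == j)%:R.
  rewrite chart_fieldE // expr2 -mulrA; congr (_ * _).
  have [_ /(_ i)[/(_ _ Vq) db _]] := Cb 1%N.
  have dx := is_derive_coord (c q) (delta_mx 0 i) j.
  have dcst := is_derive_cst (c q 0 j) (c q) (delta_mx 0 i).
  have D := is_deriveM (derivableP db) (is_deriveB dx dcst).
  have nE : {near c q, b * ((fun z : 'rV[R]_n => z 0 j) - cst (c q 0 j)) =1
      (chart_coord j - c q 0 j *: chart_bump) \o chart_inv c}.
    apply: (near_open_eq oV _ Vq) => z Vz; have [dz cz] := chart_inv_dom (Vc Vz).
    have -> : ((chart_coord j - c q 0 j *: chart_bump) \o chart_inv c) z =
      chart_coord j (chart_inv c z) - c q 0 j * chart_bump (chart_inv c z) by [].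
    by rewrite chart_coordE ?cz // chart_bumpE ?cz // !fctE; ring.
  have [_ ->] := near_eq_is_derive nE D.
  rewrite !fctE subrr scale0r addr0 !mxE eqxx /= subr0 eq_sym.
  by rewrite [_ *: _]/(_ * _).
have := aE (chart_coord j - c q 0 j *: chart_bump).
rewrite (eq_bigr _ (fun i _ => congr1 (fun r => a i * r) (D i))).
rewrite (bigD1 j) //= big1 => [|i ij]; last by rewrite (negbTE ij) !mulr0.
rewrite eqxx mulr1 addr0 => /eqP; rewrite mulf_eq0 expf_eq0 (negbTE bq) andbF orbF.
by move/eqP.
Qed.

End BumpedChart.
End LocalFrame.

(** * Linear forms on vector fields *)

Section MusicalIsomorphism.
Variables (R : realType) (n : nat) (M : smooth_manifold R n).
Local Notation F := (smooth_fun M).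
Local Notation XM := (vector_field M).

(** The factor [d] clears the bump functions, so that the expansion of a field in
    a frame near [p] is stated on the whole of [M]. *)
Lemma local_frame (p : M) :
  exists (d : F) (A : 'I_n -> XM -> F) (E : 'I_n -> XM),
    [/\ d p != 0, forall X, d *: X = \sum_(i < n) A i X *: E i &
        forall a : 'I_n -> R,
          (forall f : F, \sum_(i < n) a i * (E i f : F) p = 0) ->
          forall i, a i = 0].
Proof.
have [c cM cp] := mfd_cover M p.
have Up : (c @` chart_dom c) (c p) by exists p.
have [V [K [b [[oV VU Vp] starV [KV cK] [Cb b0 bp]]]]] :=
  exists_bump (chart_img_open c) Up.
have Kb x : ~ K x -> b x = 0 by exact: b0.
exists (chart_bump cM oV VU KV cK Cb Kb ^+ 3), (fun i X =>
  chart_bump cM oV VU KV cK Cb Kb * X (chart_coord cM oV VU KV cK Cb Kb i) -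
  chart_coord cM oV VU KV cK Cb Kb i * X (chart_bump cM oV VU KV cK Cb Kb)),
  (chart_field cM oV VU KV cK Cb Kb); split.
- rewrite -[X in X != 0]/(chart_bump cM oV VU KV cK Cb Kb p ^+ 3).
  by rewrite chart_bumpE // expf_eq0.
- by move=> X; exact: chart_field_decomposition.
- by move=> a aE; exact: (chart_field_free cp Vp bp aE).
Qed.

Variable g : riemannian_metric M.

Lemma vf_at_linear (h : F) (X Y : XM) p :
  vf_at (h *: X + Y) p = h p *: vf_at X p + vf_at Y p.
Proof. by apply: val_inj; apply/funext. Qed.

Lemma metric_app_linear (h : F) (X Y Z : XM) :
  metric_app g (h *: X + Y) Z = h * metric_app g X Z + metric_app g Y Z.
Proof.
apply: smooth_fun_ext => p.
rewrite -[LHS]/(g p (vf_at (h *: X + Y) p) (vf_at Z p)).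
by rewrite vf_at_linear metric_linear.
Qed.

Lemma metric_appC (X Y : XM) : metric_app g X Y = metric_app g Y X.
Proof.
apply: smooth_fun_ext => p.
rewrite -[LHS]/(g p (vf_at X p) (vf_at Y p)).
exact: Defs.metric_sym.
Qed.

Lemma metric_app0l (Z : XM) : metric_app g 0 Z = 0.
Proof.
have := metric_app_linear 1 0 0 Z.
by rewrite scale1r addr0 mul1r -[LHS]addr0 => /addrI.
Qed.

Lemma metric_appZl (h : F) (X Z : XM) :
  metric_app g (h *: X) Z = h * metric_app g X Z.
Proof. by rewrite -[h *: X]addr0 metric_app_linear metric_app0l addr0. Qed.

Lemma metric_appDl (X Y Z : XM) :
  metric_app g (X + Y) Z = metric_app g X Z + metric_app g Y Z.
Proof. by rewrite -[X in X + Y]scale1r metric_app_linear mul1r. Qed.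

Lemma metric_app_suml (I : Type) (r : seq I) (A : I -> F) (E : I -> XM) Z :
  metric_app g (\sum_(i <- r) A i *: E i) Z =
  \sum_(i <- r) A i * metric_app g (E i) Z.
Proof.
elim: r => [|i r IH]; first by rewrite !big_nil metric_app0l.
by rewrite !big_cons metric_app_linear IH.
Qed.

Lemma metric_app_eq0 (X : XM) p : metric_app g X X p = 0 ->
  forall f : F, (X f : F) p = 0.
Proof.
rewrite -[X in X = _]/(g p (vf_at X p) (vf_at X p)) => gX f.
have [X0|/(metric_posdef g)] := eqVneq (vf_at X p) 0; last by rewrite gX ltxx.
by rewrite -[LHS]/(vf_at X p f) X0.
Qed.

Lemma metric_app_inj (X Y : XM) :
  (forall Z, metric_app g X Z = metric_app g Y Z) -> X = Y.
Proof.
move=> XY; apply/subr0_eq/vector_field_ext => f p; apply: metric_app_eq0.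
rewrite metric_appDl -scaleN1r metric_appZl XY.
by rewrite mulN1r subrr.
Qed.

(** Named in order to carry a ring morphism structure, which commutes with the
    determinant. *)
Definition eval_at (p : M) (f : F) : R := f p.

Lemma eval_at_zmod_morphism p : zmod_morphism (eval_at p).
Proof. by []. Qed.

Lemma eval_at_monoid_morphism p : monoid_morphism (eval_at p).
Proof. by []. Qed.

HB.instance Definition _ p :=
  GRing.isZmodMorphism.Build F R (eval_at p) (eval_at_zmod_morphism p).
HB.instance Definition _ p :=
  GRing.isMonoidMorphism.Build F R (eval_at p) (eval_at_monoid_morphism p).

(** A kernel vector of the Gram matrix is a combination of the [E i] of length
    zero at [p]. *)
Lemma Gram_det_neq0 (E : 'I_n -> XM) p :
  (forall a : 'I_n -> R,
     (forall f : F, \sum_(i < n) a i * (E i f : F) p = 0) -> forall i, a i = 0) ->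
  (\det (\matrix_(i, j) metric_app g (E i) (E j))) p != 0.
Proof.
move=> freeE.
have -> : (\det (\matrix_(i, j) metric_app g (E i) (E j))) p =
    \det (\matrix_(i, j) metric_app g (E i) (E j) p).
  rewrite -[LHS]/(eval_at p _) -det_map_mx.
  by congr (\det _); apply/matrixP => i j; rewrite !mxE.
apply/det0P => -[v v0 vG]; case/negP: v0; apply/eqP/rowP => i; rewrite mxE.
pose W : XM := \sum_(i < n) (v 0 i *: (1 : F)) *: E i.
have vE (j : 'I_n) (f : F) : (v 0 j *: (1 : F) * f) p = v 0 j * f p.
  by rewrite -[LHS]/(v 0 j * 1 * f p) mulr1.
have WE k : metric_app g W (E k) p = 0.
  rewrite metric_app_suml smooth_fun_sumE; under eq_bigr do rewrite vE.
  have := congr1 (fun A : 'rV[R]_n => A 0 k) vG; rewrite !mxE => vGk.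
  by rewrite -[RHS]vGk; apply: eq_bigr => j _; rewrite mxE.
have WW : metric_app g W W p = 0.
  rewrite {1}/W metric_app_suml smooth_fun_sumE big1 // => j _.
  by rewrite vE metric_appC WE mulr0.
apply: (freeE (v 0)) => f; rewrite -[RHS](metric_app_eq0 WW f).
by rewrite vector_field_sumE; apply: eq_bigr => j _; rewrite -[v 0 j in LHS]mulr1.
Qed.

Definition linear_form (alpha : XM -> F) : Prop :=
  forall (h : F) X Y, alpha (h *: X + Y) = h * alpha X + alpha Y.

Lemma linear_form0 alpha : linear_form alpha -> alpha 0 = 0.
Proof.
by move=> /(_ 1 0 0); rewrite scale1r addr0 mul1r -[LHS]addr0 => /addrI.
Qed.

Lemma linear_form_sum alpha (I : Type) (r : seq I) (A : I -> F) (E : I -> XM) :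
  linear_form alpha ->
  alpha (\sum_(i <- r) A i *: E i) = \sum_(i <- r) A i * alpha (E i).
Proof.
move=> la; elim: r => [|i r IH]; first by rewrite !big_nil linear_form0.
by rewrite !big_cons la IH.
Qed.

(** Cramer's rule for the Gram matrix of a local frame, kept free of
    denominators. *)
Lemma local_sharp alpha p : linear_form alpha ->
  exists Wd : XM * F, Wd.2 p != 0 /\
    forall X, metric_app g Wd.1 X = Wd.2 * alpha X.
Proof.
move=> la; have [d [A [E [dp dE freeE]]]] := local_frame p.
pose G := \matrix_(i, j) metric_app g (E i) (E j).
pose B i := \sum_(j < n) alpha (E j) * (\adj G) j i.
pose W := \sum_(i < n) B i *: E i.
have WE k : metric_app g W (E k) = \det G * alpha (E k).
  rewrite metric_app_suml /B; under eq_bigr do rewrite mulr_suml.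
  rewrite exchange_big /=.
  rewrite (eq_bigr (fun j => alpha (E j) * (\adj G *m G) j k)) => [|j _].
    rewrite mul_adj_mx (bigD1 k) //= big1 => [|j jk]; last first.
      by rewrite mxE (negbTE jk) mulr0.
    by rewrite mxE eqxx addr0 mulrC.
  rewrite mxE mulr_sumr; apply: eq_bigr => i _; rewrite mulrA; congr (_ * _).
  by rewrite mxE.
exists (d *: W, \det G * d); split=> /= [|X].
  rewrite -[X in X != 0]/((\det G) p * d p) mulf_neq0 //.
  exact: Gram_det_neq0.
rewrite metric_appZl -mulrA.
have -> : d * alpha X = alpha (d *: X).
  by rewrite -[d *: X]addr0 la linear_form0 // addr0.
rewrite metric_appC -metric_appZl dE metric_app_suml linear_form_sum // mulr_sumr.
by apply: eq_bigr => i _; rewrite metric_appC WE mulrCA.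
Qed.

(** The local solutions agree up to their denominators, because the metric
    is nondegenerate; dividing them pointwise therefore yields a smooth field. *)
Lemma sharp alpha : linear_form alpha ->
  exists W : XM, forall X, metric_app g W X = alpha X.
Proof.
move=> la; have [Wd WdP] := choice (fun p => local_sharp p la).
pose w (f : F) (q : M) : R := ((Wd q).1 f : F) q / (Wd q).2 q.
have wE f p q : (Wd p).2 q * w f q = ((Wd p).1 f : F) q.
  have E : (Wd q).2 *: (Wd p).1 = (Wd p).2 *: (Wd q).1.
    apply: metric_app_inj => Z.
    by rewrite !metric_appZl (WdP p).2 (WdP q).2 mulrCA.
  have := congr1 (fun X : XM => (X f : F) q) E.
  rewrite !vector_field_scaleE /w mulrA => <-.
  by rewrite mulrAC mulfV ?mul1r // (WdP q).1.
have w_smooth f : w f \in smooth_pred M.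
  apply: smooth_local_quotient => p; exists ((Wd p).1 f), (Wd p).2.
  by split=> [|q]; [exact: (WdP p).1|exact: wE].
have wP : (fun f => SmoothFun (w_smooth f) : F^o) \in vector_field_pred M.
  apply/asboolP; split=> [a f h|f h]; apply: smooth_fun_ext => q;
    have [lW dW] := vector_fieldP (Wd q).1.
  - rewrite !smooth_funE /= /w lW !smooth_funE; ring.
  - rewrite !smooth_funE /= /w dW !smooth_funE; ring.
exists (VectorField wP) => X; apply: smooth_fun_ext => q.
have E : (Wd q).2 *: VectorField wP = (Wd q).1.
  by apply: vector_field_ext => f z; rewrite vector_field_scaleE -wE.
have : metric_app g ((Wd q).2 *: VectorField wP) X q = metric_app g (Wd q).1 X q.
  by rewrite E.
rewrite metric_appZl (WdP q).2 !smooth_funE.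
by move/(mulfI (WdP q).1).
Qed.

End MusicalIsomorphism.

(** * Connections preserving a pair of complementary orthogonal distributions *)

Section ProjectedKoszul.
Variables (R : realType) (n : nat) (M : smooth_manifold R n).
Variable g : riemannian_metric M.
Local Notation F := (smooth_fun M).
Local Notation XM := (vector_field M).
Local Notation G := (metric_app g).
Implicit Types (X Y Z : XM) (f h : F).

(** The derivation [X] with values in the ring [F] instead of the module [F^o], so
    that its values can be multiplied in ring identities. *)
Definition der X f : F := X f.

Lemma derD X f h : der X (f + h) = der X f + der X h.
Proof. exact: vector_fieldD. Qed.

Lemma derM X f h : der X (f * h) = der X f * h + f * der X h.
Proof. by have [_] := vector_fieldP X; apply. Qed.

Lemma der_linear h X Y f : der (h *: X + Y) f = h * der X f + der Y f.
Proof. by []. Qed.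

Lemma lie_bracketC X Y : lie_bracket X Y = - lie_bracket Y X.
Proof.
apply: vector_field_ext => f p.
rewrite -[LHS]/((X (Y f) : F) p - (Y (X f) : F) p).
rewrite -[RHS]/(- ((Y (X f) : F) p - (X (Y f) : F) p)).
by rewrite opprB.
Qed.

Lemma lie_bracket_linear X h Y Z : lie_bracket X (h *: Y + Z) =
  der X h *: Y + (h *: lie_bracket X Y + lie_bracket X Z).
Proof.
apply: vector_field_ext => f p.
have [_ dX] := vector_fieldP X.
rewrite -[LHS]/((X (h * Y f + Z f : F) : F) p -
  (h p * (Y (X f) : F) p + (Z (X f) : F) p)).
rewrite vector_fieldD dX.
rewrite -[LHS]/((X h : F) p * (Y f : F) p + h p * (X (Y f) : F) p + (X (Z f) : F) p -
  (h p * (Y (X f) : F) p + (Z (X f) : F) p)).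
rewrite -[RHS]/((X h : F) p * (Y f : F) p +
  (h p * ((X (Y f) : F) p - (Y (X f) : F) p) + ((X (Z f) : F) p - (Z (X f) : F) p))).
ring.
Qed.

Lemma metric_app_linear_r h X Y Z : G Z (h *: X + Y) = h * G Z X + G Z Y.
Proof. by rewrite metric_appC metric_app_linear !(metric_appC g Z). Qed.

Lemma metric_appNl X Y : G (- X) Y = - G X Y.
Proof. by rewrite -scaleN1r metric_appZl mulN1r. Qed.

Lemma lie_bracket_linear_l h X Y Z : lie_bracket (h *: X + Y) Z =
  (- der Z h) *: X + (h *: lie_bracket X Z + lie_bracket Y Z).
Proof.
rewrite lie_bracketC lie_bracket_linear (lie_bracketC Z X) (lie_bracketC Z Y).
by rewrite !opprD scaleNr scalerN !opprK.
Qed.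

Lemma smooth_fun_double_inj f h : f + f = h + h -> f = h.
Proof.
move=> E; apply: smooth_fun_ext => p; have := congr1 (fun k : F => k p) E.
rewrite !smooth_funE; lra.
Qed.

Variable P : XM -> XM.
Hypothesis linP : forall h X Y, P (h *: X + Y) = h *: P X + P Y.
Hypothesis PP : forall X, P (P X) = P X.
Hypothesis gP : forall X Y, G (P X) Y = G X (P Y).

(** The right-hand side of Koszul's formula with [P X] in place of [X] in the
    three terms that involve no differentiation along [X]. *)
Definition Koszul X Y Z : F :=
  der X (G Y Z) + der Y (G (P X) Z) - der Z (G (P X) Y)
  + G (lie_bracket X Y) Z - G (lie_bracket X Z) Y - G (lie_bracket Y Z) (P X).

Lemma Koszul_linear3 h X Y Z Z' :
  Koszul X Y (h *: Z + Z') = h * Koszul X Y Z + Koszul X Y Z'.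
Proof.
rewrite /Koszul !metric_app_linear_r !derD !derM !der_linear.
rewrite !lie_bracket_linear !metric_app_linear.
rewrite (metric_appC g Z Y) (metric_appC g Z (P X)).
ring.
Qed.

(** The symmetry of [P] cancels the derivatives of [h] along [Y] and [Z]. *)
Lemma Koszul_linear1 h X X' Y Z : P Y = Y -> P Z = Z ->
  Koszul (h *: X + X') Y Z = h * Koszul X Y Z + Koszul X' Y Z.
Proof.
move=> PY PZ; rewrite /Koszul linP !metric_app_linear_r !metric_app_linear.
rewrite !derD !derM !der_linear.
rewrite !lie_bracket_linear_l !metric_app_linear.
rewrite !gP PY PZ.
ring.
Qed.

Lemma Koszul_linear2 h X Y Y' Z :
  Koszul X (h *: Y + Y') Z =
  h * Koszul X Y Z + Koszul X Y' Z + (der X h * G Y Z + der X h * G Y Z).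
Proof.
rewrite /Koszul !metric_app_linear_r !metric_app_linear.
rewrite !derD !derM !der_linear !lie_bracket_linear.
rewrite !lie_bracket_linear_l !metric_app_linear.
rewrite (metric_appC g Y (P X)).
ring.
Qed.

Lemma Koszul_metric X Y Z : Koszul X Y Z + Koszul X Z Y = der X (G Y Z) + der X (G Y Z).
Proof.
rewrite /Koszul (lie_bracketC Z Y) metric_appNl (metric_appC g Z Y).
ring.
Qed.

Lemma projected_connection : exists N : XM -> XM -> XM,
  forall X Y Z, G (N X Y) Z + G (N X Y) Z = Koszul X (P Y) (P Z).
Proof.
pose alpha (XY : XM * XM) Z := 2^-1 *: Koszul XY.1 (P XY.2) (P Z).
have la XY : linear_form (alpha XY).
  move=> h Z Z'; rewrite /alpha linP Koszul_linear3.
  by apply: smooth_fun_ext => p; rewrite !smooth_funE; ring.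
have [N NP] := choice (fun XY => sharp g (la XY)).
exists (fun X Y => N (X, Y)) => X Y Z; rewrite NP /alpha /=.
by apply: smooth_fun_ext => p; rewrite !smooth_funE; field.
Qed.

Section Uniqueness.
Variable nabla : XM -> XM -> XM.
Hypothesis nablaP : forall X Y, nabla X (P Y) = P (nabla X Y).
Hypothesis nabla_metric : forall X Y Z,
  der X (G Y Z) = G (nabla X Y) Z + G Y (nabla X Z).
Hypothesis torsion_sym : forall X Y Z, P X = X -> P Z = Z ->
  G (torsion nabla X Y) Z = G (torsion nabla Z Y) X.

Lemma torsionC X Y : torsion nabla X Y = - torsion nabla Y X.
Proof.
rewrite /torsion (lie_bracketC X Y) !opprD !opprK.
by rewrite [- nabla Y X + _]addrC addrAC.
Qed.

Lemma lie_bracket_torsion X Y Z : G (lie_bracket X Y) Z =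
  G (nabla X Y) Z - G (nabla Y X) Z - G (torsion nabla X Y) Z.
Proof.
rewrite /torsion !metric_appDl !metric_appNl; ring.
Qed.

(** The form [g (T (X, Y), Z)] is skew in its first two arguments and symmetric in
    the outer two; alternating the two symmetries three times returns it with the
    opposite sign. *)
Lemma torsion_eq0 X Y Z : P X = X -> P Y = Y -> P Z = Z ->
  G (torsion nabla X Y) Z = 0.
Proof.
move=> PX PY PZ; apply: smooth_fun_double_inj; rewrite addr0.
have sk A B C : G (torsion nabla A B) C = - G (torsion nabla B A) C.
  by rewrite torsionC metric_appNl.
rewrite {1}torsion_sym // sk torsion_sym // sk torsion_sym // sk.
by rewrite !opprK addNr.
Qed.

(** Expanding the brackets by the torsion leaves three torsion terms: two cancel by
    symmetry, and the third has all its arguments in the image of [P]. *)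
Lemma Koszul_formula X Y Z : P Y = Y -> P Z = Z ->
  G (nabla X Y) Z + G (nabla X Y) Z = Koszul X Y Z.
Proof.
move=> PY PZ; rewrite /Koszul !nabla_metric !lie_bracket_torsion.
rewrite (torsion_eq0 PY PZ (PP X)) !nablaP !gP PY PZ.
rewrite [torsion nabla X Y]torsionC [torsion nabla X Z]torsionC !metric_appNl.
rewrite (torsion_sym X PY PZ).
rewrite (metric_appC g Y (nabla X Z)) (metric_appC g X (P (nabla Y Z))).
rewrite (metric_appC g X (P (nabla Z Y))) !gP.
ring.
Qed.

End Uniqueness.

(** The part of the torsion that is not visibly symmetric in [X] and [Z] drops out
    of the two Koszul expressions that compute it. *)
Lemma Koszul_torsion nabla :
  (forall X Y Z, P Z = Z ->
     G (nabla X Y) Z + G (nabla X Y) Z = Koszul X (P Y) Z) ->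
  forall X Y Z, P X = X -> P Z = Z ->
    G (torsion nabla X Y) Z = G (torsion nabla Z Y) X.
Proof.
move=> nablaE X Y Z PX PZ; apply: smooth_fun_double_inj.
have E A C : P A = A -> P C = C ->
    G (torsion nabla A Y) C + G (torsion nabla A Y) C =
    Koszul A (P Y) C - Koszul Y A C
    - (G (lie_bracket A Y) C + G (lie_bracket A Y) C).
  move=> PA PC; have := nablaE Y A C PC; rewrite PA => <-; rewrite -nablaE //.
  rewrite /torsion !metric_appDl !metric_appNl; ring.
rewrite !E // /Koszul PX PZ.
rewrite (lie_bracketC Y X) (lie_bracketC Y Z) (lie_bracketC Z X).
rewrite (lie_bracketC (P Y) X) (lie_bracketC (P Y) Z) !metric_appNl.
rewrite (metric_appC g (P Y) X) (metric_appC g (P Y) Z).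
rewrite (metric_appC g Z X).
ring.
Qed.

End ProjectedKoszul.

Section ComplementaryProjectors.
Variables (R : realType) (n : nat) (M : smooth_manifold R n).
Variable g : riemannian_metric M.
Local Notation F := (smooth_fun M).
Local Notation XM := (vector_field M).
Local Notation G := (metric_app g).
Variables P Q : XM -> XM.
Hypotheses (linP : forall h X Y, P (h *: X + Y) = h *: P X + P Y)
           (linQ : forall h X Y, Q (h *: X + Y) = h *: Q X + Q Y).
Hypotheses (PP : forall X, P (P X) = P X) (QQ : forall X, Q (Q X) = Q X).
Hypotheses (gP : forall X Y, G (P X) Y = G X (P Y))
           (gQ : forall X Y, G (Q X) Y = G X (Q Y)).
Hypothesis PQ : forall X, P X + Q X = X.

Let P0 : P 0 = 0.
Proof. by apply: (@addrI _ (P 0)); rewrite -{1}[P 0]scale1r -linP scale1r !addr0. Qed.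
Let Q0 : Q 0 = 0.
Proof. by apply: (@addrI _ (Q 0)); rewrite -{1}[Q 0]scale1r -linQ scale1r !addr0. Qed.

Let PQ0 X : P (Q X) = 0.
Proof.
have := congr1 P (PQ X); rewrite -[P X in LHS]scale1r linP scale1r PP.
by rewrite -[RHS]addr0 => /addrI.
Qed.

Let QP0 X : Q (P X) = 0.
Proof.
have := congr1 Q (PQ X); rewrite -[P X in LHS]scale1r linQ scale1r QQ.
by rewrite -[RHS]add0r => /addIr.
Qed.

Let Koszul0 (S : XM -> XM) X Y : Koszul g S X Y 0 = 0.
Proof.
have := Koszul_linear3 g S 1 X Y 0 0.
by rewrite scale1r addr0 mul1r -[LHS]addr0 => /addrI.
Qed.

Lemma metric_app_double_inj (X Y : XM) :
  (forall Z, G X Z + G X Z = G Y Z + G Y Z) -> X = Y.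
Proof.
by move=> XY; apply: (@metric_app_inj _ _ _ g) => Z; exact: smooth_fun_double_inj.
Qed.

Definition torsion_symmetric_image (S : XM -> XM) (N : XM -> XM -> XM) : Prop :=
  forall X Y Z, S X = X -> S Z = Z ->
    G (torsion N X Y) Z = G (torsion N Z Y) X.

Definition well_adapted (N : XM -> XM -> XM) : Prop :=
  [/\ derivation_law N, forall X Y, N X (P Y) = P (N X Y),
      forall X Y, N X (Q Y) = Q (N X Y),
      forall X Y Z, covariant_derivative_metric N g X Y Z = 0 &
      torsion_symmetric_image P N /\ torsion_symmetric_image Q N].

(** Such a connection preserves both images, so its products with [Z] split into
    two terms, each given by [Koszul_formula]. *)
Lemma well_adapted_unique N N' : well_adapted N -> well_adapted N' -> N = N'.
Proof.
suff E N0 : well_adapted N0 -> forall X Y Z, G (N0 X Y) Z + G (N0 X Y) Z =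
    Koszul g P X (P Y) (P Z) + Koszul g Q X (Q Y) (Q Z).
  move=> wN wN'; apply/funext => X; apply/funext => Y.
  by apply: metric_app_double_inj => Z; rewrite !E.
move=> [[_ addN _] NPP NQQ Ng [symP symQ]] X Y Z.
have Nmetric A B C : der A (G B C) = G (N0 A B) C + G B (N0 A C).
  have := Ng A B C; rewrite /covariant_derivative_metric => /eqP.
  by rewrite -addrA -opprD subr_eq0 => /eqP.
rewrite -{1 2}[Y]PQ addN !metric_appDl.
rewrite -(Koszul_formula PP gP NPP Nmetric symP X (PP Y) (PP Z)).
rewrite -(Koszul_formula QQ gQ NQQ Nmetric symQ X (QQ Y) (QQ Z)).
rewrite -!gP -!gQ -!NPP -!NQQ PP QQ.
ring.
Qed.

(** The sum of the connections that the two Koszul expressions define on the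
    images of [P] and [Q]. *)
Lemma well_adapted_exists : exists N, well_adapted N.
Proof.
have [NP NPE] := projected_connection g linP.
have [NQ NQE] := projected_connection g linQ.
pose nabla X Y := NP X Y + NQ X Y.
have nablaE X Y Z : G (nabla X Y) Z + G (nabla X Y) Z =
    Koszul g P X (P Y) (P Z) + Koszul g Q X (Q Y) (Q Z).
  by rewrite -NPE -NQE /nabla metric_appDl; ring.
have PE X Y : P (nabla X Y) = NP X Y.
  apply: metric_app_double_inj => Z.
  by rewrite gP nablaE PP QP0 Koszul0 addr0 NPE.
have QE X Y : Q (nabla X Y) = NQ X Y.
  apply: metric_app_double_inj => Z.
  by rewrite gQ nablaE QQ PQ0 Koszul0 add0r NQE.
have Koszul00 (S : XM -> XM) X Z : Koszul g S X 0 Z = 0.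
  have := Koszul_metric g S X 0 Z; rewrite Koszul0 metric_app0l addr0 => ->.
  by rewrite /der vector_field0 addr0.
have metric_split Y Z : G (P Y) (P Z) + G (Q Y) (Q Z) = G Y Z.
  by rewrite -gP -gQ PP QQ -metric_appDl PQ.
have nabla_Leibniz f X Y Z :
    nabla X (f *: Y + Z) = der X f *: Y + (f *: nabla X Y + nabla X Z).
  apply: metric_app_double_inj => W.
  rewrite nablaE linP linQ !Koszul_linear2 !metric_app_linear -(metric_split Y W).
  have := nablaE X Y W; have := nablaE X Z W.
  move: (G (nabla X Y) W) (G (nabla X Z) W) => u v Eu Ev.
  transitivity (f * (u + u) + (v + v) +
    der X f * (G (P Y) (P W) + G (Q Y) (Q W) + G (P Y) (P W) + G (Q Y) (Q W))); last ring.
  rewrite Eu Ev; ring.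
have nabla0 X : nabla X 0 = 0.
  apply: metric_app_double_inj => Z.
  by rewrite nablaE P0 Q0 !Koszul00 metric_app0l.
exists nabla; split.
- split=> [f X Y Z|X Y Z|f X Y].
  + apply: metric_app_double_inj => W.
    rewrite nablaE (Koszul_linear1 linP gP) ?PP // (Koszul_linear1 linQ gQ) ?QQ //.
    rewrite metric_app_linear.
    have := nablaE X Z W; have := nablaE Y Z W.
    move: (G (nabla X Z) W) (G (nabla Y Z) W) => u v Ev Eu.
    transitivity (f * (u + u) + (v + v)); last ring.
    rewrite Eu Ev; ring.
  + have := nabla_Leibniz 1 X Y Z; rewrite !scale1r => ->.
    by rewrite /der vector_field1 scale0r add0r.
  + by have := nabla_Leibniz f X Y 0; rewrite !addr0 nabla0 addr0 => ->.
- move=> X Y; rewrite PE; apply: metric_app_double_inj => Z.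
  by rewrite nablaE PP QP0 Koszul00 addr0 NPE.
- move=> X Y; rewrite QE; apply: metric_app_double_inj => Z.
  by rewrite nablaE QQ PQ0 Koszul00 add0r NQE.
- move=> X Y Z; apply/eqP; rewrite /covariant_derivative_metric -addrA -opprD subr_eq0.
  apply/eqP; apply: (smooth_fun_double_inj (f := der X (G Y Z))).
  rewrite (metric_appC g Y (nabla X Z)) -{1 2}(metric_split Y Z) !derD.
  rewrite addrACA -(Koszul_metric g P) -(Koszul_metric g Q).
  rewrite [RHS]addrACA !nablaE.
  ring.
- split.
  + apply: (Koszul_torsion (P := P)) => // X Y Z PZ.
    rewrite nablaE PZ.
    have -> : Q Z = 0 by rewrite -PZ QP0.
    by rewrite Koszul0 addr0.
  + apply: (Koszul_torsion (P := Q)) => // X Y Z QZ.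
    rewrite nablaE QZ.
    have -> : P Z = 0 by rewrite -QZ PQ0.
    by rewrite Koszul0 add0r.
Qed.

End ComplementaryProjectors.

(** * Eigenprojectors of the Golden structure *)

Section GoldenProjectors.
Variables (R : realType) (n : nat) (M : smooth_manifold R n).
Local Notation F := (smooth_fun M).
Local Notation XM := (vector_field M).

Lemma golden_ratioD : golden_ratio + golden_ratio_conj = 1 :> R.
Proof. by rewrite /golden_ratio /golden_ratio_conj; field. Qed.

Lemma golden_ratioM : golden_ratio * golden_ratio_conj = -1 :> R.
Proof.
rewrite /golden_ratio /golden_ratio_conj mulrACA [(1 + _) * _]mulrC -subr_sqr.
rewrite sqr_sqrtr ?ler0n //.
by field.
Qed.

Lemma golden_ratioB_neq0 : golden_ratio - golden_ratio_conj != 0 :> R.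
Proof.
rewrite (_ : _ - _ = Num.sqrt 5 :> R).
  by rewrite gt_eqF // sqrtr_gt0 ltr0n.
by rewrite /golden_ratio /golden_ratio_conj; field.
Qed.

Definition cst_fun (r : R) : F := r *: (1 : F).

Lemma cst_funE r p : cst_fun r p = r.
Proof. by rewrite -[LHS]/(r * 1) mulr1. Qed.

Lemma vector_field_cst (X : XM) r : X (cst_fun r) = 0.
Proof.
have [lX _] := vector_fieldP X.
by rewrite /cst_fun -[_ *: _]addr0 lX vector_field1 vector_field0 scaler0 addr0.
Qed.

Variables (phi : tensor11 M) (g : riemannian_metric M).
Hypothesis gold : almost_golden_riemannian phi g.
Local Notation T := (tensor11_app phi).

Lemma tensor11_appE (X : XM) (f : F) p : (T X f : F) p = phi p (vf_at X p) f.
Proof. by []. Qed.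

Lemma vf_at_tensor11_app (X : XM) p : vf_at (T X) p = phi p (vf_at X p).
Proof. by apply: val_inj; apply/funext. Qed.

Lemma tensor11_app_linear (h : F) X Y : T (h *: X + Y) = h *: T X + T Y.
Proof.
apply: vector_field_ext => f p.
by rewrite tensor11_appE vf_at_linear linearP.
Qed.

Lemma tensor11_appZ (h : F) X : T (h *: X) = h *: T X.
Proof.
apply: vector_field_ext => f p; rewrite tensor11_appE.
have -> : vf_at (h *: X) p = h p *: vf_at X p by apply: val_inj; apply/funext.
by rewrite linearZ.
Qed.

Lemma golden_app_sqr X : T (T X) = T X + X.
Proof.
apply: vector_field_ext => f p.
rewrite tensor11_appE vf_at_tensor11_app.
by have [[-> _] _] := gold.
Qed.

Section Eigenprojector.
Variables c c' : R.
Hypotheses (cD : c + c' = 1) (cM : c * c' = -1) (cB : c - c' != 0).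

(** [(phi - c' Id) / (c - c')], the projector onto the kernel of [phi - c Id] along
    that of [phi - c' Id] when [c] and [c'] are the roots of [x^2 - x - 1]. *)
Definition eigenprojector (X : XM) : XM :=
  cst_fun (c - c')^-1 *: T X + cst_fun (- c' / (c - c')) *: X.

Lemma eigenprojectorE X (f : F) p : (eigenprojector X f : F) p =
  (c - c')^-1 * (T X f : F) p + (- c' / (c - c')) * (X f : F) p.
Proof.
by rewrite vector_field_addE !vector_field_scaleE !cst_funE.
Qed.

Lemma eigenprojector_linear h X Y :
  eigenprojector (h *: X + Y) = h *: eigenprojector X + eigenprojector Y.
Proof.
apply: vector_field_ext => f p.
rewrite eigenprojectorE tensor11_app_linear.
rewrite !(vector_field_addE, vector_field_scaleE) !cst_funE.
ring.
Qed.

Lemma eigenprojector_idem X : eigenprojector (eigenprojector X) = eigenprojector X.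
Proof.
apply: vector_field_ext => f p.
have TP : T (eigenprojector X) =
    cst_fun (c - c')^-1 *: (T X + X) + cst_fun (- c' / (c - c')) *: T X.
  by rewrite /eigenprojector tensor11_app_linear tensor11_appZ golden_app_sqr.
rewrite [LHS]eigenprojectorE TP vector_field_addE !vector_field_scaleE.
rewrite vector_field_addE !cst_funE eigenprojectorE.
move: ((T X f : F) p) ((X f : F) p) => t x.
set k := (c - c')^-1; have kE : k * (c - c') = 1 by rewrite mulVf.
have k2 : k * k + 2 * (- c' * k) * k = k.
  transitivity (k * (k * ((c + c') - 2 * c'))); first by rewrite cD; ring.
  by rewrite [X in _ * (_ * X)](_ : _ = c - c') ?kE ?mulr1 //; ring.
have k1 : k * k + (- c' * k) * (- c' * k) = - c' * k.
  transitivity (k * k * (c' * c' - c * c')); first by rewrite cM; ring.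
  by transitivity (- c' * k * (k * (c - c'))); [ring|rewrite kE mulr1].
transitivity ((k * k + 2 * (- c' * k) * k) * t +
  (k * k + (- c' * k) * (- c' * k)) * x); first by ring.
by rewrite k2 k1.
Qed.

Lemma eigenprojector_sym X Y :
  metric_app g (eigenprojector X) Y = metric_app g X (eigenprojector Y).
Proof.
have [_ gT] := gold.
rewrite /eigenprojector metric_app_linear metric_app_linear_r gT.
by rewrite metric_appZl (metric_appC g X (_ *: Y)) metric_appZl (metric_appC g Y X).
Qed.

Lemma eigenprojector_fixed X :
  vf_in (eigendistribution phi c) X <-> eigenprojector X = X.
Proof.
split=> [DX|PX].
  apply: vector_field_ext => f p; rewrite eigenprojectorE tensor11_appE.
  have /subr0_eq -> := DX p.
  rewrite -[(c *: vf_at X p) f]/(c * (X f : F) p).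
  by field.
move=> p; apply/eqP; rewrite /eigendistribution /= subr_eq0; apply/eqP.
apply: val_inj; apply/funext => f.
have := congr1 (fun W : XM => (W f : F) p) PX.
rewrite eigenprojectorE tensor11_appE => E.
rewrite -[LHS]/(phi p (vf_at X p) f) -[RHS]/(c * (X f : F) p).
move: (phi p (vf_at X p) f) ((X f : F) p) E => t x E.
transitivity ((c - c') * ((c - c')^-1 * t + - c' / (c - c') * x) + c' * x).
  by field.
by rewrite E; ring.
Qed.

Lemma torsion_symmetric_onE nabla :
  torsion_symmetric_on (eigendistribution phi c) g nabla <->
  (forall X Y Z, eigenprojector X = X -> eigenprojector Z = Z ->
     metric_app g (torsion nabla X Y) Z = metric_app g (torsion nabla Z Y) X).
Proof.
split=> [S X Y Z /eigenprojector_fixed DX /eigenprojector_fixed DZ|S X Z Y].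
  exact: S.
by move=> /eigenprojector_fixed DX /eigenprojector_fixed DZ; exact: S.
Qed.

Lemma derivation_law_cst nabla X r Y : derivation_law nabla ->
  nabla X (cst_fun r *: Y) = cst_fun r *: nabla X Y.
Proof.
move=> [_ _ leib]; rewrite leib.
have -> : (X (cst_fun r) : F) = 0 by exact: vector_field_cst.
by rewrite scale0r add0r.
Qed.

Lemma eigenprojector_parallel nabla : derivation_law nabla ->
  (forall X Y, covariant_derivative_tensor11 nabla phi X Y = 0) ->
  forall X Y, nabla X (eigenprojector Y) = eigenprojector (nabla X Y).
Proof.
move=> law par X Y; have [_ addn _] := law.
rewrite /eigenprojector addn !(derivation_law_cst _ _ _ law).
by rewrite (subr0_eq (par X Y : nabla X (T Y) - T (nabla X Y) = 0)).
Qed.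

End Eigenprojector.

Lemma eigenprojectorD X :
  eigenprojector golden_ratio golden_ratio_conj X +
  eigenprojector golden_ratio_conj golden_ratio X = X.
Proof.
apply: vector_field_ext => f p.
rewrite [LHS]vector_field_addE.
rewrite [X in X + _]eigenprojectorE.
rewrite [X in _ + X]eigenprojectorE.
have := golden_ratioB_neq0.
move: (golden_ratio : R) (golden_ratio_conj : R) => c c' cB.
have cB' : c' - c != 0 by rewrite -opprB oppr_eq0.
by field; rewrite cB cB'.
Qed.

(** What makes a connection that commutes with both projectors commute with
    [phi]. *)
Lemma golden_spectral X : T X =
  cst_fun golden_ratio *: eigenprojector golden_ratio golden_ratio_conj X +
  cst_fun golden_ratio_conj *: eigenprojector golden_ratio_conj golden_ratio X.
Proof.
apply: vector_field_ext => f p.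
rewrite [RHS]vector_field_addE.
rewrite [X in _ = X + _]vector_field_scaleE [X in _ = _ + X]vector_field_scaleE.
rewrite !cst_funE [X in _ = _ * X + _]eigenprojectorE.
rewrite [X in _ = _ + _ * X]eigenprojectorE.
have := golden_ratioB_neq0.
move: (golden_ratio : R) (golden_ratio_conj : R) => c c' cB.
have cB' : c' - c != 0 by rewrite -opprB oppr_eq0.
by field; rewrite cB cB'.
Qed.

End GoldenProjectors.

Theorem theorem4p6 (R : realType) (n : nat) (M : smooth_manifold R n)
    (phi : tensor11 M) (g : riemannian_metric M)
    (hphig : almost_golden_riemannian phi g) :
  exists! nabla : vector_field M -> vector_field M -> vector_field M,
    [/\ derivation_law nabla,
        adapted_to phi g nabla,
        torsion_symmetric_on (eigendistribution phi golden_ratio) g nabla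
      & torsion_symmetric_on (eigendistribution phi golden_ratio_conj) g nabla].
Proof.
pose c : R := golden_ratio; pose c' : R := golden_ratio_conj.
have cD : c + c' = 1 := golden_ratioD R.
have cM : c * c' = -1 := golden_ratioM R.
have cB : c - c' != 0 := golden_ratioB_neq0 R.
have cD' : c' + c = 1 by rewrite addrC.
have cM' : c' * c = -1 by rewrite mulrC.
have cB' : c' - c != 0 by rewrite -opprB oppr_eq0.
pose P := eigenprojector phi c c'; pose Q := eigenprojector phi c' c.
have linP := eigenprojector_linear phi c c'.
have linQ := eigenprojector_linear phi c' c.
have PP := eigenprojector_idem hphig cD cM cB.
have QQ := eigenprojector_idem hphig cD' cM' cB'.
have gP := eigenprojector_sym hphig c c'.
have gQ := eigenprojector_sym hphig c' c.
have PQ : forall X, P X + Q X = X := eigenprojectorD phi.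
have symP := torsion_symmetric_onE phi g cB.
have symQ := torsion_symmetric_onE phi g cB'.
have [nabla [law nP nQ ng [sP sQ]]] :=
  well_adapted_exists linP linQ PP QQ gP gQ PQ.
have [_ addn _] := law.
exists nabla; split.
  split=> //; last 2 first.
  - exact/symP.
  - exact/symQ.
  split=> // X Y; rewrite /covariant_derivative_tensor11 !golden_spectral addn.
  by rewrite !(derivation_law_cst _ _ _ law) nP nQ subrr.
move=> nabla' [law' [par' ng'] sP' sQ'].
apply: (well_adapted_unique PP QQ gP gQ PQ); split=> //.
- by move=> X Y; apply: eigenprojector_parallel.
- by move=> X Y; apply: eigenprojector_parallel.
- by split; [apply/symP|apply/symQ].
Qed.
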